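(* Let $n\ge 1$, $1\le r\le n$, let $F:\mathbb{R}^{n\times n}\to\mathbb{R}$ be twice continuously differentiable, $\mu_F$-strongly convex and $L_F$-smooth, let $f(X)=F(XX^T)$ for $X\in\mathbb{R}^{n\times r}$, let $g:\mathbb{R}^{n\times r}\to\mathbb{R}\cup\{+\infty\}$ be closed, convex and proper, let $\Psi=f+g$, and suppose $\min_{\mathbb{R}^{n\times r}}\Psi>-\infty$. Assume that: 1. $f$ is $L$-smooth relative to a distance kernel $h:\mathbb{R}^{n\times r}\to\mathbb{R}$ such that $h$ is strongly convex and twice continuously differentiable on $\mathbb{R}^{n\times r}$; 2. $\Psi$ is coercive (that is, $\Psi(X)\to+\infty$ when $\|X\|\to+\infty$) and semialgebraic. Let $\{X^k\}_{k\ge 0}$ be a sequence generated by the Dyn-NoLips algorithm with kernel $h$. Then the sequence $\{\Psi(X^k)\}_{k\ge 0}$ is nonincreasing, and the sequence $\{X^k\}_{k\ge 0}$ converges to a critical point $X^*$ of the problem $\min_{X\in\mathbb{R}^{n\times r}}\Psi(X)$.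
   Context: $\|\cdot\|$ is the Frobenius norm and $\langle X,Y\rangle=\mathrm{Tr}(X^TY)$ the associated inner product; gradients are taken with respect to it. $F$ is $\mu_F$-strongly convex and $L_F$-smooth, with constants $0\le\mu_F\le L_F$, means that for all $X,Y\in\mathbb{R}^{n\times n}$, $\langle\nabla F(X)-\nabla F(Y),X-Y\rangle\ge\mu_F\|X-Y\|^2$ and $\|\nabla F(X)-\nabla F(Y)\|\le L_F\|X-Y\|$. A distance kernel is a differentiable strictly convex function $h:\mathbb{R}^{n\times r}\to\mathbb{R}$; its Bregman distance is $D_h(X,Y)=h(X)-h(Y)-\langle\nabla h(Y),X-Y\rangle$. The function $f$ is $L$-smooth relative to $h$ ($L>0$) if $f(X)\le f(Y)+\langle\nabla f(Y),X-Y\rangle+L\,D_h(X,Y)$ for all $X,Y\in\mathbb{R}^{n\times r}$. The Bregman iteration map with step size $\lambda>0$ is $$T_\lambda(X)=\operatorname*{argmin}_{U\in\mathbb{R}^{n\times r}}\Big\{g(U)+f(X)+\langle\nabla f(X),U-X\rangle+\frac1\lambda D_h(U,X)\Big\}.$$ The Dyn-NoLips algorithm: given a maximal step size $\lambda_{\max}>0$, initialize $X^0\in\mathbb{R}^{n\times r}$ with $\Psi(X^0)<\infty$. For $k=1,2,\dots$, choose a step size $0<\lambda_k\le\lambda_{\max}$ such that $X^k:=T_{\lambda_k}(X^{k-1})$ satisfies the sufficient decrease condition $$f(X^k)\le f(X^{k-1})+\langle\nabla f(X^{k-1}),X^k-X^{k-1}\rangle+\frac1{\lambda_k}D_h(X^k,X^{k-1}),$$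 and take this $X^k$ as the next iterate. The step sizes are chosen by one of the following two rules. (i) Fixed step size: $\lambda_k=\lambda$ for all $k$, for a constant $0<\lambda\le\min(1/L,\lambda_{\max})$ (the sufficient decrease condition then holds automatically by relative smoothness). (ii) Dynamical step size: start from some tentative step size $0<\bar\lambda_1\le\lambda_{\max}$; at iteration $k$, given the tentative step size $\bar\lambda_k$, let $j$ be the smallest nonnegative integer such that the sufficient decrease condition holds with step size $2^{-j}\bar\lambda_k$; set $\lambda_k=2^{-j}\bar\lambda_k$ and take the next tentative step size $\bar\lambda_{k+1}=\min(2^{-j+1}\bar\lambda_k,\lambda_{\max})$. A critical point of $\Psi=f+g$ is a point $X^*$ with $0\in\nabla f(X^* )+\partial g(X^* )$, where $\partial g$ is the convex subdifferential. A function is semialgebraic if its graph is a semialgebraic set. *)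

(* Defs.v *)
From mathcomp Require Import all_boot all_order all_algebra.
From mathcomp Require Import all_classical all_reals all_analysis.
From mathcomp Require mpoly.

Set Implicit Arguments.
Unset Strict Implicit.
Unset Printing Implicit Defensive.

Import Order.TTheory GRing.Theory Num.Theory.
Import numFieldNormedType.Exports.

Local Open Scope classical_set_scope.
Local Open Scope ring_scope.

Section matrix_calculus.
Context {R : realType} {m n : nat}.
Implicit Types (X Y V : 'M[R]_(m, n)) (h : 'M[R]_(m, n) -> R).

Definition frob_dot X Y : R := \tr (X^T *m Y).

(* The library's norm `|X| on matrices is the max norm (inducing the same
   topology); the Frobenius norm has to be defined separately. *)
Definition frob_norm X : R := Num.sqrt (frob_dot X X).

(* Only meaningful at points where h is differentiable: see frob_dot_grad. *)
Definition grad h X : 'M[R]_(m, n) :=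
  \matrix_(i < m, j < n) 'D_(delta_mx i j) h X.

Lemma frob_dot_grad h X V :
  differentiable h X -> frob_dot (grad h X) V = 'd h X V.
Proof.
move=> dh; rewrite [in RHS](matrix_sum_delta V) linear_sum /=.
transitivity (\sum_j \sum_i grad h X i j * V i j).
  by apply: eq_bigr => j _; rewrite mxE; apply: eq_bigr => i _; rewrite mxE.
rewrite exchange_big /=; apply: eq_bigr => i _.
rewrite linear_sum /=; apply: eq_bigr => j _.
by rewrite linearZ /= mxE deriveE// mulrC.
Qed.

(* In finite dimension, continuity of X |-> 'd (grad h) X for the operator
   norm amounts to continuity of X |-> 'd (grad h) X V for every V. *)
Definition twice_continuously_differentiable h : Prop :=
  [/\ forall X, differentiable h X,
      forall X, differentiable (grad h) X &
      forall V, continuous (fun X => 'd (grad h) X V)].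

Definition strongly_convex (mu : R) h : Prop :=
  forall X Y, frob_dot (grad h X - grad h Y) (X - Y)
              >= mu * frob_norm (X - Y) ^+ 2.

Definition smooth (L : R) h : Prop :=
  forall X Y, frob_norm (grad h X - grad h Y) <= L * frob_norm (X - Y).

Definition strictly_convex h : Prop :=
  forall X Y (t : R), X != Y -> 0 < t < 1 ->
    h (t *: X + (1 - t) *: Y) < t * h X + (1 - t) * h Y.

Definition distance_kernel h : Prop :=
  (forall X, differentiable h X) /\ strictly_convex h.

Definition bregman h X Y : R :=
  h X - h Y - frob_dot (grad h Y) (X - Y).

Definition relatively_smooth (L : R) (f h : 'M[R]_(m, n) -> R) : Prop :=
  forall X Y,
    f X <= f Y + frob_dot (grad f Y) (X - Y) + L * bregman h X Y.

End matrix_calculus.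

Section extended_valued.
Context {R : realType} {m n : nat}.
Implicit Types (g Psi : 'M[R]_(m, n) -> \bar R) (X Y V : 'M[R]_(m, n)).

Definition proper_fun g : Prop :=
  (forall X, g X != -oo%E) /\ (exists X, (g X < +oo)%E).

Definition closed_fun g : Prop :=
  closed [set p : 'M[R]_(m, n) * R | (g p.1 <= p.2%:E)%E].

Definition convex_fun g : Prop :=
  forall X Y (t : R), 0 < t < 1 ->
    (g (t *: X + (1 - t) *: Y)%R <= t%:E * g X + (1 - t)%R%:E * g Y)%E.

Definition subdifferential g X : set 'M[R]_(m, n) :=
  [set V | forall Y, (g X + (frob_dot V (Y - X))%R%:E <= g Y)%E].

Definition coercive Psi : Prop :=
  forall A : R, exists B : R, forall X, B < frob_norm X -> (A%:E < Psi X)%E.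

End extended_valued.

(* Finite unions of sets given by finitely many polynomial equations and
   strict inequalities: each pair in s lists the polynomials required to
   vanish and those required to be positive. *)
Definition semialgebraic_set {R : realType} {d : nat} (S : set 'rV[R]_d) : Prop :=
  exists s : seq (seq (mpoly.mpoly d R) * seq (mpoly.mpoly d R)),
    S = [set x | has (fun PQ =>
           all (fun p => mpoly.meval (x ord0) p == 0) PQ.1 &&
           all (fun q => 0 < mpoly.meval (x ord0) q) PQ.2) s].

(* The graph of an extended-valued function only contains its finite values;
   'M_(m, n) * R is identified with 'rV_(m * n + 1) through mxvec. *)
Definition semialgebraic_fun {R : realType} {m n : nat}
    (Psi : 'M[R]_(m, n) -> \bar R) : Prop :=
  semialgebraic_set
    [set row_mx (mxvec p.1) (p.2%:M : 'rV[R]_1) |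
       p in [set p : 'M[R]_(m, n) * R | Psi p.1 = p.2%:E]].

Section dyn_nolips.
Context {R : realType} {n r : nat}.
Variables (f : 'M[R]_(n, r) -> R) (g : 'M[R]_(n, r) -> \bar R).
Variable h : 'M[R]_(n, r) -> R.
Implicit Types (X U V : 'M[R]_(n, r)) (lambda : R).

Definition objective X : \bar R := ((f X)%:E + g X)%E.

Definition bregman_model lambda X U : \bar R :=
  (g U + (f X + frob_dot (grad f X) (U - X)
          + lambda^-1 * bregman h U X)%R%:E)%E.

(* The iteration map T_lambda as a set of minimizers: it has at most one
   element when g is proper and convex and h is strictly convex, so that
   U = T_lambda(X) is rendered as bregman_map lambda X U. *)
Definition bregman_map lambda X : set 'M[R]_(n, r) :=
  [set U | forall V, (bregman_model lambda X U <= bregman_model lambda X V)%E].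

Definition sufficient_decrease lambda X U : Prop :=
  f U <= f X + frob_dot (grad f X) (U - X) + lambda^-1 * bregman h U X.

Definition admissible_step lambda X U : Prop :=
  bregman_map lambda X U /\ sufficient_decrease lambda X U.

Definition fixed_step_rule (L lambda_max : R) (lambda : nat -> R) : Prop :=
  exists2 l : R, 0 < l <= Num.min L^-1 lambda_max & forall k, lambda k = l.

(* Step sizes are indexed from 0: lambda k produces X k.+1 from X k, and
   tent k is the tentative step size available at that iteration. *)
Definition dynamical_step_rule (lambda_max : R)
    (lambda : nat -> R) (X : nat -> 'M[R]_(n, r)) : Prop :=
  exists (tent : nat -> R) (j : nat -> nat),
    0 < tent 0%N <= lambda_max /\
    forall k,
      [/\ lambda k = 2 ^- j k * tent k,
          exists U, admissible_step (2 ^- j k * tent k) (X k) U,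
          forall i, (i < j k)%N ->
            ~ exists U, admissible_step (2 ^- i * tent k) (X k) U &
          tent k.+1 = Num.min (2 * 2 ^- j k * tent k) lambda_max].

Definition dyn_nolips (L lambda_max : R) (X : nat -> 'M[R]_(n, r)) : Prop :=
  (objective (X 0%N) < +oo)%E /\
  exists lambda : nat -> R,
    (forall k, 0 < lambda k <= lambda_max /\
               admissible_step (lambda k) (X k) (X k.+1)) /\
    (fixed_step_rule L lambda_max lambda \/
     dynamical_step_rule lambda_max lambda X).

Definition critical_point X : Prop :=
  exists2 V, subdifferential g X V & grad f X + V = 0.

End dyn_nolips.

(* Main.v *)
From HB Require Import structures.
Require Import Defs.
From mathcomp Require Import all_boot all_order all_algebra.
From mathcomp Require Import all_classical all_reals all_analysis.
From mathcomp Require mpoly.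
From mathcomp Require ordered_qelim qe_rcf.
From mathcomp Require Import ring lra.

(** Why the iterates converge.

    Write d_k for the length of the k-th step. Three facts hold along the
    iterates: Psi drops by at least a constant times d_k^2
    ([bregman_map_decrease]); Psi has at X_(k+1) a subgradient W_k, the
    residual of the optimality condition of the Bregman step, of norm at most
    a constant times d_k; and the iterates stay in a ball, because Psi is
    coercive. The second fact needs the step sizes to be bounded below
    ([step_lower_bound]): any step size at most 1/L is accepted, since the
    model minimized by the step then dominates Psi, hence is coercive and has
    a minimizer ([admissible_step_exists]). If the total length of the steps
    is finite, the limit is critical, because W_k tends to 0 and the graph of
    the convex subdifferential is closed.

    That the length is finite is where semialgebraicity enters, through a
    Kurdyka-Lojasiewicz inequality on the whole ball ([desingularization]):
    there is a bounded nondecreasing phi such that, for 0 < s < t small and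
    every subgradient w with |w| <= 1 at a point of the ball where Psi takes
    the value v0 + t, v0 being the limit of the values along the iterates, one
    has  t - s <= |w| (phi t - phi s).  Together with the decrease it bounds
    d_(k+1)^2 by d_k (phi(e_k) - phi(e_(k+1))) up to a constant, where e_k is
    Psi(X_(k+1)) - v0, and the arithmetic-geometric inequality makes the
    lengths summable ([finite_length]).

    In the main case phi is built as follows. Among the pairs (x, w) at level
    v0 + t choose one with |w| minimal, and break ties by successively
    minimizing the entries of x. The entries of the chosen x(t) and the norm
    of the chosen w(t) are then first-order definable functions of t.
    Quantifier elimination over real closed fields shows that a definable
    predicate of one real variable is eventually true or eventually false to
    the right of 0 ([definable_germ0]), whence a definable function is
    eventually strictly monotone or constant ([monotone_germ]). So the entries
    of x(t) are monotone near 0, and phi, their sum with suitable signs, has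
    increments that bound the displacement of x(t). The error of the linear
    lower bound of Psi given by a subgradient is quadratic in the
    displacement, so t - s <= |w(t)| (phi t - phi s) + rho (phi t - phi s)^2,
    and an induction along the interval from s to t removes the quadratic term
    ([lipschitz_of_quadratic]). *)

Set Implicit Arguments.
Unset Strict Implicit.
Unset Printing Implicit Defensive.

Import Order.TTheory GRing.Theory Num.Theory.
Import numFieldNormedType.Exports.

Local Open Scope classical_set_scope.
Local Open Scope ring_scope.

(** * First-order definable predicates over the reals *)

Module QE := ordered_qelim.ord.

Section definable.
Variable R : realType.

(** Polynomial functions on a type C whose points are described by the list cs
    of coordinate functions. Working over an arbitrary C, and forming products
    with R or with matrices to go under a quantifier, lets definability be
    proved on ordinary predicates, without variable names. *)
Inductive polyfun (C : Type) (cs : seq (C -> R)) : (C -> R) -> Prop :=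
| polyfun_cst a : polyfun cs (fun=> a)
| polyfun_coord i : (i < size cs)%N -> polyfun cs (nth (fun=> 0) cs i)
| polyfunD p q : polyfun cs p -> polyfun cs q -> polyfun cs (fun c => p c + q c)
| polyfunM p q : polyfun cs p -> polyfun cs q -> polyfun cs (fun c => p c * q c).

Definition coords (C : Type) (cs : seq (C -> R)) (c : C) : seq R :=
  [seq k c | k <- cs].

(** The formula is evaluated at the coordinates of the point and may contain
    arbitrary real constants, so that parameters are allowed. *)
Definition definable (C : Type) (cs : seq (C -> R)) (P : C -> Prop) : Prop :=
  exists2 f : QE.formula R, QE.rformula f & forall c, QE.holds (coords cs c) f <-> P c.

Section closure.
Variables (C : Type) (cs : seq (C -> R)).
Implicit Types (P Q : C -> Prop) (p q : C -> R).

Lemma polyfun_ext p q : (forall c, p c = q c) -> polyfun cs p -> polyfun cs q.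
Proof. by move=> /funext ->. Qed.

Lemma polyfunN p : polyfun cs p -> polyfun cs (fun c => - p c).
Proof.
move=> hp; apply: (@polyfun_ext (fun c => -1 * p c)) => [c|].
  by rewrite mulN1r.
by apply: polyfunM => //; apply: polyfun_cst.
Qed.

Lemma polyfunB p q :
  polyfun cs p -> polyfun cs q -> polyfun cs (fun c => p c - q c).
Proof. by move=> hp hq; apply: polyfunD => //; apply: polyfunN. Qed.

Lemma polyfunX p k : polyfun cs p -> polyfun cs (fun c => p c ^+ k).
Proof.
move=> hp; elim: k => [|k ih].
  by apply: (polyfun_ext _ (polyfun_cst _ 1)) => c; rewrite expr0.
by apply: (polyfun_ext _ (polyfunM hp ih)) => c; rewrite exprS.
Qed.

Lemma polyfun_sum (I : Type) (r : seq I) (p : I -> C -> R) :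
  (forall i, polyfun cs (p i)) -> polyfun cs (fun c => \sum_(i <- r) p i c).
Proof.
move=> hp; elim: r => [|i r ih].
  by apply: (polyfun_ext _ (polyfun_cst _ 0)) => c; rewrite big_nil.
by apply: (polyfun_ext _ (polyfunD (hp i) ih)) => c; rewrite big_cons.
Qed.

Lemma polyfun_prod (I : Type) (r : seq I) (p : I -> C -> R) :
  (forall i, polyfun cs (p i)) -> polyfun cs (fun c => \prod_(i <- r) p i c).
Proof.
move=> hp; elim: r => [|i r ih].
  by apply: (polyfun_ext _ (polyfun_cst _ 1)) => c; rewrite big_nil.
by apply: (polyfun_ext _ (polyfunM (hp i) ih)) => c; rewrite big_cons.
Qed.

Lemma polyfun_term p : polyfun cs p ->
  exists2 t : GRing.term R, GRing.rterm t &
    forall c, GRing.eval (coords cs c) t = p c.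
Proof.
elim=> [a|i isz|? ? _ [t rt tE] _ [u ru uE]|? ? _ [t rt tE] _ [u ru uE]].
- by exists (GRing.Const a).
- by exists (GRing.Var R i) => //= c; rewrite (nth_map (fun=> 0)).
- by exists (GRing.Add t u) => /= [|c]; rewrite ?rt ?tE ?uE.
- by exists (GRing.Mul t u) => /= [|c]; rewrite ?rt ?tE ?uE.
Qed.

Lemma definable_ext P Q :
  (forall c, P c <-> Q c) -> definable cs P -> definable cs Q.
Proof. by move=> PQ [f rf fP]; exists f => // c; rewrite fP. Qed.

Lemma definable_lt p q :
  polyfun cs p -> polyfun cs q -> definable cs (fun c => p c < q c).
Proof.
move=> /polyfun_term[t rt tE] /polyfun_term[u ru uE].
by exists (QE.Lt t u) => /= [|c]; rewrite ?rt ?tE ?uE.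
Qed.

Lemma definable_not P : definable cs P -> definable cs (fun c => ~ P c).
Proof. by move=> [f rf fP]; exists (QE.Not f) => //= c; rewrite fP. Qed.

Lemma definable_and P Q :
  definable cs P -> definable cs Q -> definable cs (fun c => P c /\ Q c).
Proof.
move=> [f rf fP] [g rg gQ].
by exists (QE.And f g) => /= [|c]; rewrite ?rf ?fP ?gQ.
Qed.

Lemma definable_or P Q :
  definable cs P -> definable cs Q -> definable cs (fun c => P c \/ Q c).
Proof.
move=> [f rf fP] [g rg gQ].
by exists (QE.Or f g) => /= [|c]; rewrite ?rf ?fP ?gQ.
Qed.

Lemma definable_imp P Q :
  definable cs P -> definable cs Q -> definable cs (fun c => P c -> Q c).
Proof.
move=> [f rf fP] [g rg gQ].
by exists (QE.Implies f g) => /= [|c]; rewrite ?rf ?fP ?gQ.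
Qed.

Lemma definable_le p q :
  polyfun cs p -> polyfun cs q -> definable cs (fun c => p c <= q c).
Proof.
move=> hp hq; apply: (@definable_ext (fun c => ~ q c < p c)) => [c|].
  by rewrite leNgt; split=> /negP.
by apply/definable_not/definable_lt.
Qed.

Lemma definable_eq p q :
  polyfun cs p -> polyfun cs q -> definable cs (fun c => p c = q c).
Proof.
move=> hp hq; apply: (@definable_ext (fun c => p c <= q c /\ q c <= p c)).
  by move=> c; split=> [[? ?]|-> //]; apply/le_anti/andP.
by apply: definable_and; apply: definable_le.
Qed.

Lemma definable_cst (A : Prop) : definable cs (fun=> A).
Proof.
have [hA|hA] := pselect A; first by exists (QE.Bool true).
by exists (QE.Bool false).
Qed.

Lemma definable_has (I : Type) (s : seq I) (P : I -> C -> bool) :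
  (forall i, definable cs (fun c => P i c)) ->
  definable cs (fun c => has (P^~ c) s).
Proof.
move=> hP; elim: s => [|i s ih]; first exact: (definable_cst (is_true false)).
apply: (definable_ext _ (definable_or (hP i) ih)) => c.
by rewrite /=; split=> /orP.
Qed.

Lemma definable_all (I : Type) (s : seq I) (P : I -> C -> bool) :
  (forall i, definable cs (fun c => P i c)) ->
  definable cs (fun c => all (P^~ c) s).
Proof.
move=> hP; elim: s => [|i s ih]; first exact: (definable_cst (is_true true)).
apply: (definable_ext _ (definable_and (hP i) ih)) => c.
by rewrite /=; split=> /andP.
Qed.

Lemma polyfun_meval (d : nat) (v : C -> 'I_d -> R) (p : mpoly.mpoly d R) :
  (forall i, polyfun cs (fun c => v c i)) ->
  polyfun cs (fun c => mpoly.meval (v c) p).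
Proof.
move=> hv; apply: (polyfun_ext (fun c => esym (mpoly.mevalE (v c) p))).
apply: polyfun_sum => m; apply: polyfunM; first exact: polyfun_cst.
by apply: polyfun_prod => i; apply: polyfunX.
Qed.

Lemma definable_semialgebraic (d : nat) (S : set 'rV[R]_d) (v : C -> 'rV[R]_d) :
  semialgebraic_set S ->
  (forall i, polyfun cs (fun c => v c ord0 i)) -> definable cs (fun c => S (v c)).
Proof.
move=> [s ->] hv.
pose atom (L : seq (mpoly.mpoly d R) * seq (mpoly.mpoly d R)) c :=
  all (fun a => mpoly.meval (v c ord0) a == 0) L.1 &&
  all (fun a => 0 < mpoly.meval (v c ord0) a) L.2.
apply: (@definable_has _ _ atom) => L.
apply: (@definable_ext (fun c => all (fun a => mpoly.meval (v c ord0) a == 0) L.1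
   /\ all (fun a => 0 < mpoly.meval (v c ord0) a) L.2)) => [c|].
  by split=> /andP.
apply: definable_and.
  apply: (@definable_all _ _ (fun a c => mpoly.meval (v c ord0) a == 0)) => a.
  apply: (@definable_ext (fun c => mpoly.meval (v c ord0) a = 0)) => [c|].
    by split=> /eqP.
  by apply: definable_eq; [exact: polyfun_meval|exact: polyfun_cst].
apply: (@definable_all _ _ (fun a c => 0 < mpoly.meval (v c ord0) a)) => a.
by apply: definable_lt; [exact: polyfun_cst|exact: polyfun_meval].
Qed.

End closure.

Lemma polyfun_id : polyfun [:: id] (fun t : R => t).
Proof. by have := @polyfun_coord R [:: id] 0 isT. Qed.

(** Weakening: a polynomial function may be read in any larger context. *)
Lemma polyfun_comp (C D : Type) (cs : seq (C -> R)) (ds : seq (D -> R))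
    (k : D -> C) (p : C -> R) :
  (forall i, (i < size cs)%N ->
    polyfun ds (fun d => nth (fun=> 0) cs i (k d))) ->
  polyfun cs p -> polyfun ds (fun d => p (k d)).
Proof.
move=> hk; elim=> [a|i isz|? ? _ hp _ hq|? ? _ hp _ hq].
- exact: polyfun_cst.
- exact: hk.
- exact: polyfunD.
- exact: polyfunM.
Qed.

Definition ext_coords (C : Type) (cs : seq (C -> R)) : seq (C * R -> R) :=
  rcons [seq (fun p => k p.1) | k <- cs] (fun p => p.2).

Definition ext_coords_mx (C : Type) (m n : nat) (cs : seq (C -> R)) :
    seq (C * 'M[R]_(m, n) -> R) :=
  [seq (fun p => k p.1) | k <- cs] ++
  [seq (fun p => mxvec p.2 ord0 i) | i <- enum 'I_(m * n)].

Section quantifiers.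
Variables (C : Type) (cs : seq (C -> R)).

Lemma coords_ext c x : coords (ext_coords cs) (c, x) = rcons (coords cs c) x.
Proof. by rewrite /coords /ext_coords map_rcons -map_comp. Qed.

Lemma polyfun_fst p :
  polyfun cs p -> polyfun (ext_coords cs) (fun c => p c.1).
Proof.
apply: polyfun_comp => i isz.
have -> : (fun d : C * R => nth (fun=> 0) cs i d.1) =
    nth (fun=> 0) (ext_coords cs) i.
  by rewrite nth_rcons size_map isz (nth_map (fun=> 0)).
by apply: polyfun_coord; rewrite size_rcons size_map ltnS ltnW.
Qed.

Lemma polyfun_snd : polyfun (ext_coords cs) (fun c => c.2).
Proof.
have -> : (fun d : C * R => d.2) = nth (fun=> 0) (ext_coords cs) (size cs).
  by rewrite nth_rcons size_map ltnn eqxx.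
by apply: polyfun_coord; rewrite size_rcons size_map.
Qed.

Lemma set_nth_size (e : seq R) x : set_nth 0 e (size e) x = rcons e x.
Proof. by elim: e => //= y e ->. Qed.

(** The quantified variable is appended after the coordinates of the context,
    which makes it the variable of index [size cs]. *)
Lemma definable_ex (P : C -> R -> Prop) :
  definable (ext_coords cs) (fun c => P c.1 c.2) ->
  definable cs (fun c => exists x, P c x).
Proof.
move=> [f rf fP]; exists (QE.Exists (size cs) f) => //= c.
have E x : set_nth 0 (coords cs c) (size cs) x = coords (ext_coords cs) (c, x).
  by rewrite coords_ext -set_nth_size size_map.
by split=> -[x hx]; exists x; [apply/(fP (c, x)); rewrite -E|rewrite E; apply/fP].
Qed.

Lemma definable_all_real (P : C -> R -> Prop) :
  definable (ext_coords cs) (fun c => P c.1 c.2) ->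
  definable cs (fun c => forall x, P c x).
Proof.
move=> hP; apply: (@definable_ext _ _ (fun c => ~ exists x, ~ P c x)) => [c|].
  by split=> [/forallNP + x|hc [x]]; [move/(_ x)/contrapT|apply].
by apply/definable_not/definable_ex/definable_not.
Qed.

Fixpoint exists_block (k d : nat) (f : QE.formula R) : QE.formula R :=
  if k is k'.+1 then QE.Exists d (exists_block k' d.+1 f) else f.

Lemma rformula_exists_block k d f :
  QE.rformula (exists_block k d f) = QE.rformula f.
Proof. by elim: k d => //= k ih d; rewrite ih. Qed.

Lemma holds_exists_block k e f :
  QE.holds e (exists_block k (size e) f) <->
  exists2 s, size s = k & QE.holds (e ++ s) f.
Proof.
elim: k e => [|k ih] e /=.
  split=> [he|[s /size0nil ->]]; last by rewrite cats0.
  by exists [::]; rewrite ?cats0.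
have E x : exists_block k (size e).+1 f = exists_block k (size (rcons e x)) f.
  by rewrite size_rcons.
split=> [[x]|[[//|x s] /= [sz] hs]].
  rewrite set_nth_size (E x) => /ih[s sz hs].
  by exists (x :: s); rewrite /= ?sz // -cat_rcons.
by exists x; rewrite set_nth_size (E x); apply/ih; exists s; rewrite ?cat_rcons.
Qed.

Section matrix_quantifiers.
Variables m n : nat.

Lemma coords_ext_mx c (w : 'M[R]_(m, n)) :
  coords (ext_coords_mx m n cs) (c, w) =
  coords cs c ++ [seq mxvec w ord0 i | i <- enum 'I_(m * n)].
Proof. by rewrite /coords /ext_coords_mx map_cat -!map_comp. Qed.

Lemma polyfun_fst_mx p :
  polyfun cs p -> polyfun (ext_coords_mx m n cs) (fun c => p c.1).
Proof.
apply: polyfun_comp => i isz.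
have -> : (fun d : C * 'M[R]_(m, n) => nth (fun=> 0) cs i d.1) =
    nth (fun=> 0) (ext_coords_mx m n cs) i.
  by rewrite nth_cat size_map isz (nth_map (fun=> 0)).
by apply: polyfun_coord; rewrite size_cat size_map (leq_trans isz)// leq_addr.
Qed.

Lemma polyfun_snd_mx i j : polyfun (ext_coords_mx m n cs) (fun c => c.2 i j).
Proof.
pose k := mxvec_index i j.
have -> : (fun d : C * 'M[R]_(m, n) => d.2 i j) =
    nth (fun=> 0) (ext_coords_mx m n cs) (size cs + k).
  rewrite nth_cat size_map ltnNge leq_addr /= addKn.
  have kl : (k < size (enum 'I_(m * n)))%N by rewrite size_enum_ord.
  rewrite (nth_map k _ _ kl) -[nth k _ _]/(nth k (enum 'I_(m * n)) k) nth_ord_enum.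
  by apply/funext => d; rewrite mxvecE.
have sz : size (ext_coords_mx m n cs) = (size cs + m * n)%N.
  by rewrite size_cat 2!size_map size_enum_ord.
by apply: polyfun_coord; rewrite sz ltn_add2l.
Qed.

Lemma definable_ex_mx (P : C -> 'M[R]_(m, n) -> Prop) :
  definable (ext_coords_mx m n cs) (fun c => P c.1 c.2) ->
  definable cs (fun c => exists x, P c x).
Proof.
move=> [f rf fP]; exists (exists_block (m * n) (size cs) f).
  by rewrite rformula_exists_block.
move=> c; have E : size cs = size (coords cs c) by rewrite size_map.
rewrite {1}E; split=> [/holds_exists_block[s sz]|[w hw]].
  pose w : 'M[R]_(m, n) := vec_mx (\row_i nth 0 s i).
  suff -> : s = [seq mxvec w ord0 i | i <- enum 'I_(m * n)].
    by rewrite -coords_ext_mx => /fP; exists w.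
  have szm : size [seq mxvec w ord0 i | i <- enum 'I_(m * n)] = (m * n)%N.
    by rewrite size_map size_enum_ord.
  apply: (@eq_from_nth _ 0) => [|i]; rewrite ?szm// sz => ilt.
  rewrite (nth_map (Ordinal ilt)) ?size_enum_ord// /w vec_mxK mxE.
  by rewrite nth_enum_ord.
apply/holds_exists_block; exists [seq mxvec w ord0 i | i <- enum 'I_(m * n)].
  by rewrite size_map size_enum_ord.
by rewrite -coords_ext_mx; apply/fP.
Qed.

Lemma definable_all_mx (P : C -> 'M[R]_(m, n) -> Prop) :
  definable (ext_coords_mx m n cs) (fun c => P c.1 c.2) ->
  definable cs (fun c => forall x, P c x).
Proof.
move=> hP; apply: (@definable_ext _ _ (fun c => ~ exists x, ~ P c x)) => [c|].
  by split=> [/forallNP + x|hc [x]]; [move/(_ x)/contrapT|apply].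
by apply/definable_not/definable_ex_mx/definable_not.
Qed.

End matrix_quantifiers.
End quantifiers.

Definition germ0 (P : R -> Prop) := exists2 d, 0 < d & forall t, 0 < t < d -> P t.

Lemma germ0_and (P Q : R -> Prop) :
  germ0 P -> germ0 Q -> germ0 (fun t => P t /\ Q t).
Proof.
move=> [d d0 hd] [e e0 he]; exists (Num.min d e); first by rewrite lt_min d0.
by move=> t /andP[t0]; rewrite lt_min => /andP[td te]; split;
  [apply: hd|apply: he]; rewrite t0.
Qed.

Lemma germ0_imp (P Q : R -> Prop) :
  (forall t, 0 < t -> P t -> Q t) -> germ0 P -> germ0 Q.
Proof.
move=> PQ [d d0 hd]; exists d => // t td; apply: PQ; last exact: hd.
by case/andP: td.
Qed.

(** Factoring out the largest power of 'X leaves a polynomial that does not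
    vanish at 0, whose sign is constant near 0. *)
Lemma germ0_poly (p : {poly R}) :
  [\/ germ0 (fun t => p.[t] = 0), germ0 (fun t => 0 < p.[t]) |
      germ0 (fun t => p.[t] < 0)].
Proof.
have [->|p0] := eqVneq p 0.
  by constructor 1; exists 1 => // t _; rewrite horner0.
have [k [q]] := multiplicity_XsubC p 0; rewrite p0 /= => q0 ->.
have cq : {for 0, continuous (fun t => q.[t])} by exact: continuous_horner.
have : q.[0] != 0 by exact: q0.
have E t : (q * ('X - 0%:P) ^+ k).[t] = q.[t] * t ^+ k.
  by rewrite hornerM horner_exp hornerXsubC subr0.
case: ltgtP => // [qn|qp] _; [constructor 3|constructor 2].
  have /nbhs_ballP[d /= d0 hd] := cvgr_lt (FF := nbhs_filter (0 : R)) _ cq _ qn.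
  exists d => // t /andP[t0 td]; rewrite E pmulr_llt0 ?exprn_gt0//.
  by apply: hd; rewrite /ball /= sub0r normrN gtr0_norm.
have /nbhs_ballP[d /= d0 hd] := cvgr_gt (FF := nbhs_filter (0 : R)) _ cq _ qp.
exists d => // t /andP[t0 td]; rewrite E pmulr_lgt0 ?exprn_gt0//.
by apply: hd; rewrite /ball /= sub0r normrN gtr0_norm.
Qed.

Lemma term_poly (t : GRing.term R) : GRing.rterm t ->
  exists p : {poly R}, forall x, GRing.eval [:: x] t = p.[x].
Proof.
elim: t => //=.
- move=> [|i] _; first by exists 'X => x; rewrite hornerX.
  by exists 0 => x; rewrite horner0 /= nth_default.
- by move=> a _; exists a%:P => x; rewrite hornerC.
- by move=> k _; exists k%:R%:P => x; rewrite hornerC.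
- move=> t iht u ihu /andP[/iht[p hp] /ihu[q hq]].
  by exists (p + q) => x; rewrite hornerD hp hq.
- by move=> t iht /iht[p hp]; exists (- p) => x; rewrite hornerN hp.
- by move=> t iht k /iht[p hp]; exists (p *+ k) => x; rewrite hornerMn hp.
- move=> t iht u ihu /andP[/iht[p hp] /ihu[q hq]].
  by exists (p * q) => x; rewrite hornerM hp hq.
- by move=> t iht k /iht[p hp]; exists (p ^+ k) => x; rewrite horner_exp hp.
Qed.

(** Quantifier elimination for real closed fields, in the form of one
    equivalent quantifier-free formula for all valuations. *)
Lemma quantifier_free (f : QE.formula R) : QE.rformula f ->
  exists g : QE.formula R, [/\ QE.qf_form g, QE.rformula g &
    forall e, QE.qf_eval e g <-> QE.holds e f].
Proof.
move=> rf; pose wproj i bc := qe_rcf.qfr_to_formula (@qe_rcf.wproj R i bc).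
exists (QE.quantifier_elim wproj f).
have /andP[-> ->] := QE.quantifier_elim_wf (@qe_rcf.wf_QE_wproj R) rf.
split=> // e.
have h := QE.quantifier_elim_rformP (@qe_rcf.wf_QE_wproj R)
  (@qe_rcf.valid_QE_wproj R) e rf.
by split=> /h.
Qed.

(** A definable subset of the line is a finite union of points and intervals, seen
    here from 0: a quantifier-free formula in one variable is a boolean
    combination of sign conditions on polynomials, and each of these is
    eventually constant. *)
Lemma definable_germ0 (P : R -> Prop) :
  definable [:: id] P -> germ0 P \/ germ0 (fun t => ~ P t).
Proof.
move=> [f /quantifier_free[g [qg rg gf]] fP].
suff : germ0 (fun t => QE.qf_eval [:: t] g) \/
       germ0 (fun t => ~~ QE.qf_eval [:: t] g).
  by case=> h; [left|right]; apply: germ0_imp h => t _; rewrite -fP -gf => // /negP.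
elim: g qg rg {gf f fP} => //=.
- by move=> [] _ _; [left|right]; exists 1.
- move=> t u _ /andP[/term_poly[p hp] /term_poly[q hq]].
  have [] := germ0_poly (p - q) => h; [left|right|right]; apply: germ0_imp h => x _;
    by rewrite hornerD hornerN hp hq ?subr_gt0 ?subr_lt0;
      first [move=> /subr0_eq->; rewrite ?eqxx ?ltxx ?lexx | case: ltgtP].
- move=> t u _ /andP[/term_poly[p hp] /term_poly[q hq]].
  have [] := germ0_poly (p - q) => h; [right|right|left]; apply: germ0_imp h => x _;
    by rewrite hornerD hornerN hp hq ?subr_gt0 ?subr_lt0;
      first [move=> /subr0_eq->; rewrite ?eqxx ?ltxx ?lexx | case: ltgtP].
- move=> t u _ /andP[/term_poly[p hp] /term_poly[q hq]].
  have [] := germ0_poly (p - q) => h; [left|right|left]; apply: germ0_imp h => x _;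
    by rewrite hornerD hornerN hp hq ?subr_gt0 ?subr_lt0;
      first [move=> /subr0_eq->; rewrite ?eqxx ?ltxx ?lexx | case: ltgtP].
- move=> f ihf g ihg /andP[/ihf {}ihf /ihg {}ihg] /andP[/ihf hf /ihg hg].
  case: hf => hf.
    case: hg => hg; first by left; apply: germ0_imp (germ0_and hf hg) => t _ /andP.
    by right; apply: germ0_imp hg => t _; rewrite negb_and orbC => ->.
  by right; apply: germ0_imp hf => t _; rewrite negb_and => ->.
- move=> f ihf g ihg /andP[/ihf {}ihf /ihg {}ihg] /andP[/ihf hf /ihg hg].
  case: hf => hf; first by left; apply: germ0_imp hf => t _ ->.
  case: hg => hg; first by left; apply: germ0_imp hg => t _ ->; rewrite orbT.
  by right; apply: germ0_imp (germ0_and hf hg) => t _; rewrite negb_or => /andP.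
- move=> f ihf g ihg /andP[/ihf {}ihf /ihg {}ihg] /andP[/ihf hf /ihg hg].
  case: hf => hf; last by left; apply: germ0_imp hf => t _ /negbTE ->.
  case: hg => hg; first by left; apply: germ0_imp hg => t _ ->; rewrite implybT.
  by right; apply: germ0_imp (germ0_and hf hg) => t _ [->].
- move=> f ihf /ihf {}ihf /ihf [] hf; [right|left] => //.
  by apply: germ0_imp hf => t _; rewrite negbK.
Qed.

End definable.

(** * Monotonicity of definable functions near zero *)

Section monotonicity.
Variable R : realType.

(** Consider the supremum of the x with P a x: the left hypothesis shows that it
    has this property too, and the right one that it cannot be below b. *)
Lemma interval_induction (P : R -> R -> Prop) (a b : R) : a < b ->
  (forall x y z, a <= x -> x < y -> y < z -> z <= b -> P x y -> P y z -> P x z) ->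
  (forall t, a <= t < b ->
     exists2 d, 0 < d & forall s, t < s < t + d -> s <= b -> P t s) ->
  (forall t, a < t <= b ->
     exists2 d, 0 < d & forall s, t - d < s < t -> a <= s -> P s t) ->
  P a b.
Proof.
move=> ab Ptrans Pright Pleft.
pose S : set R := [set x | a < x <= b /\ P a x].
have aI : a <= a < b by rewrite lexx.
have [d d0 hd] := Pright a aI.
have S0 : S !=set0.
  pose s := Num.min b (a + d / 2).
  have sa : a < s by rewrite lt_min ab ltrDl divr_gt0.
  have sd : s < a + d.
    by rewrite gt_min ltrD2l ltr_pdivrMr// ltr_pMr// ltr1n orbT.
  by exists s; split; [|apply: hd]; rewrite ?sa// /s ge_min lexx.
have Sub : ubound S b by move=> x [/andP[]].
have hS : has_sup S by split => //; exists b.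
pose c := sup S.
have cb : c <= b by exact: ge_sup.
have ac : a < c.
  by have [x Sx] := S0; apply: lt_le_trans (ub_le_sup hS.2 Sx); case: Sx => /andP[].
have Pac : P a c.
  have [|e e0 he] := Pleft c; first by rewrite ac.
  have [s [/andP[asx sb] Ps] cs] := sup_adherent e0 hS.
  have : s <= c by apply: (ub_le_sup hS.2); split => //; rewrite asx.
  rewrite le_eqVlt => /predU1P[<- //|sc].
  by apply: (Ptrans a s c) => //; apply: he; rewrite ?cs ?ltW.
move: cb; rewrite le_eqVlt => /predU1P[<- //|cb].
have [|e e0 he] := Pright c; first by rewrite ltW.
pose s := Num.min b (c + e / 2).
have cs : c < s by rewrite lt_min cb ltrDl divr_gt0.
have se : s < c + e by rewrite gt_min ltrD2l ltr_pdivrMr// ltr_pMr// ltr1n orbT.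
have sb : s <= b by rewrite ge_min lexx.
suff Ss : S s by have := ub_le_sup hS.2 Ss; rewrite leNgt cs.
split; first by rewrite (lt_trans ac cs).
by apply: (Ptrans a c s) => //; apply: he; rewrite ?cs.
Qed.

(** Strict local extrema are countable: around each one there is an interval
    with rational endpoints in which it is the only extremum, so these
    endpoints determine it. Hence they cannot fill an interval. *)
Lemma no_interval_of_strict_extrema (u : R -> R) (d : R) (lt : rel R) :
  irreflexive lt -> (forall x y, lt x y -> ~~ lt y x) -> 0 < d ->
  ~ (forall t, 0 < t < d -> exists2 e, 0 < e &
       forall s, 0 < s < e -> lt (u t) (u (t + s)) /\ lt (u t) (u (t - s))).
Proof.
move=> ltxx ltasym d0 H.
have rats t : exists pq : rat * rat, 0 < t < d ->
   ratr pq.1 < t < ratr pq.2 /\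
   forall s, ratr pq.1 < s < ratr pq.2 -> s != t -> lt (u t) (u s).
  have [td|ntd] := boolP (0 < t < d); last by exists (0, 0).
  have [e e0 he] := H t td.
  have [p] : exists p : rat, ratr p \in `]t - e, t[.
    by apply: rat_in_itvoo; rewrite ltrBlDr ltrDl.
  rewrite in_itv /= => /andP[p1 p2].
  have [q] : exists q : rat, ratr q \in `]t, t + e[.
    by apply: rat_in_itvoo; rewrite ltrDl.
  rewrite in_itv /= => /andP[q1 q2].
  exists (p, q) => _ /=; split; first by rewrite p2 q1.
  move=> s /andP[ps sq]; case: (ltgtP s t) => // st _.
    have := (he (t - s)); rewrite subr_gt0 st /= subKr.
    by rewrite ltrBlDr -ltrBlDl (lt_trans p1 ps) => -[].
  have := (he (s - t)); rewrite subr_gt0 st /= subrKC.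
  by rewrite ltrBlDl (lt_trans sq q2) => -[].
pose f t := projT1 (cid (rats t)).
have fP t : 0 < t < d -> ratr (f t).1 < t < ratr (f t).2 /\
   forall s, ratr (f t).1 < s < ratr (f t).2 -> s != t -> lt (u t) (u s).
  exact: (projT2 (cid (rats t))).
have finj : {in `]0, d[%classic &, injective f}.
  move=> x y; rewrite !inE /= !in_itv /= => xd yd fxy; apply/eqP/negP => /negP xy.
  have [x1 x2] := fP _ xd; have [y1 y2] := fP _ yd.
  have := x2 y; rewrite fxy y1 eq_sym xy => /(_ isT isT) h1.
  have := y2 x; rewrite -fxy x1 xy => /(_ isT isT) /ltasym.
  by rewrite h1.
have : countable `]0, d[%classic.
  apply/countable_injP; exists (fun t => choice.pickle (f t)).
  by move=> x y xd yd /(pcan_inj choice.pickleK); exact: finj.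
move/countable_lebesgue_measure0; rewrite lebesgue_measure_itv /= lte_fin d0.
by rewrite sube0 => -[] /eqP; rewrite gt_eqF.
Qed.

(** Definability of r at any pair of polynomial arguments in any context, which
    is what instances such as r t (t + s) with t fixed or quantified need. *)
Definition definable_rel (r : R -> R -> Prop) : Prop :=
  forall (C : Type) (cs : seq (C -> R)) a b, polyfun cs a -> polyfun cs b ->
    definable cs (fun c => r (a c) (b c)).

Lemma definable_germ_rel (r : R -> R -> Prop) :
  definable_rel r -> definable [:: id] (fun t : R => germ0 (r t)).
Proof.
move=> hr; apply: (@definable_ext _ _ _
  (fun t => exists d, 0 < d /\ forall s, 0 < s /\ s < d -> r t s)) => [t|].
  split=> [[d [d0 hd]]|[d d0 hd]]; exists d => //; last split=> // s.
    by move=> s /andP sd; apply: hd.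
  by move=> /andP; apply: hd.
have pid := @polyfun_id R.
apply: definable_ex; apply: definable_and.
  by apply: definable_lt; [exact: polyfun_cst|exact: polyfun_snd].
apply: definable_all_real; apply: definable_imp.
  apply: definable_and; apply: definable_lt; try exact: polyfun_snd.
    exact: polyfun_cst.
  exact: (polyfun_fst (polyfun_snd _)).
by apply: hr; [exact: (polyfun_fst (polyfun_fst pid))|exact: polyfun_snd].
Qed.

Lemma homo_of_local (lt : R -> R -> Prop) (u : R -> R) (d : R) :
  (forall x y z, lt x y -> lt y z -> lt x z) ->
  (forall t, 0 < t < d ->
    germ0 (fun s => lt (u t) (u (t + s))) /\ germ0 (fun s => lt (u (t - s)) (u t))) ->
  forall s t, 0 < s -> s < t -> t < d -> lt (u s) (u t).
Proof.
move=> lt_trans' H s t s0 st td.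
apply: (@interval_induction (fun x y => lt (u x) (u y))) => //.
- by move=> x y z _ _ _ _; apply: lt_trans'.
- move=> x /andP[sx xt]; have [|[e e0 he] _] := H x.
    by rewrite (lt_le_trans s0 sx) (lt_trans xt td).
  exists e => // y /andP[xy ye] _; have := he (y - x).
  by rewrite subrKC subr_gt0 xy ltrBlDl ye; apply.
- move=> x /andP[sx xt]; have [|_ [e e0 he]] := H x.
    by rewrite (lt_trans s0 sx) (le_lt_trans xt td).
  exists e => // y /andP[ye yx] _; have := he (x - y).
  by rewrite subKr subr_gt0 yx ltrBlDr -ltrBlDl ye; apply.
Qed.

Section germ_of_function.
(** The relation r defines the order of the values of u on the interval from 0
    to d0; outside of it u is arbitrary. *)
Variables (u : R -> R) (r : R -> R -> Prop) (d0 : R).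
Hypothesis d0_gt0 : 0 < d0.
Hypothesis r_def : definable_rel r.
Hypothesis rE : forall s t, 0 < s < d0 -> 0 < t < d0 -> r s t <-> u s < u t.

Let near_inside (e t : R) : `|e| = 1 -> 0 < t < d0 -> germ0 (fun s => 0 < t + e * s < d0).
Proof.
move=> e1 /andP[t0 td]; exists (Num.min t (d0 - t)).
  by rewrite lt_min t0 subr_gt0.
move=> s /andP[s0]; rewrite lt_min => /andP[st]; rewrite ltrBrDl => sd.
have := ler_norm (e * s); have := ler_norm (- (e * s)).
by rewrite normrN normrM e1 mul1r gtr0_norm// => ? ?; apply/andP; lra.
Qed.

(** With e = 1 or e = -1, the comparison of u t with the values of u to the right
    or to the left of t is eventually constant in s for each t, and then
    eventually the same for all t. *)
Let germ_trichotomy (e : R) : `|e| = 1 ->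
  [\/ germ0 (fun t => germ0 (fun s => u t < u (t + e * s))),
      germ0 (fun t => germ0 (fun s => u (t + e * s) < u t)) |
      germ0 (fun t => germ0 (fun s => u (t + e * s) = u t))].
Proof.
move=> e1.
have dich (f g : R -> R -> R) :
    (forall (C : Type) (cs : seq (C -> R)) a b, polyfun cs a -> polyfun cs b ->
       polyfun cs (fun c => f (a c) (b c)) /\ polyfun cs (fun c => g (a c) (b c))) ->
    germ0 (fun t => germ0 (fun s => r (f t s) (g t s))) \/
    germ0 (fun t => germ0 (fun s => ~ r (f t s) (g t s))).
  move=> fg; have hr : definable_rel (fun t s => r (f t s) (g t s)).
    by move=> C cs a b ha hb; have [] := fg C cs a b ha hb; apply: r_def.
  case: (definable_germ0 (definable_germ_rel hr)) => h; [by left|right].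
  apply: germ0_imp h => t t0.
  have : definable [:: id] (fun s : R => r (f t s) (g t s)).
    apply: hr; first exact: polyfun_cst.
    exact: polyfun_id.
  by move=> /definable_germ0[].
have hd0 : germ0 (fun t => 0 < t < d0) by exists d0.
have pfe (C : Type) (cs : seq (C -> R)) a b : polyfun cs a -> polyfun cs b ->
    polyfun cs (fun c => a c + e * b c).
  by move=> ha hb; apply: polyfunD => //; apply: polyfunM => //; apply: polyfun_cst.
have [|h|h1] := dich (fun t s => t) (fun t s => t + e * s).
- by move=> C cs a b ha hb; split => //; apply: pfe.
- constructor 1; apply: germ0_imp (germ0_and hd0 h) => t _ [td {}h].
  by apply: germ0_imp (germ0_and (near_inside e1 td) h) => s _ [? /rE]; apply.
have [|h|h2] := dich (fun t s => t + e * s) (fun t s => t).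
- by move=> C cs a b ha hb; split => //; apply: pfe.
- constructor 2; apply: germ0_imp (germ0_and hd0 h) => t _ [td {}h].
  by apply: germ0_imp (germ0_and (near_inside e1 td) h) => s _ [? /rE]; apply.
constructor 3; apply: germ0_imp (germ0_and hd0 (germ0_and h1 h2)) => t _ [td [ha hb]].
apply: germ0_imp (germ0_and (near_inside e1 td) (germ0_and ha hb)) => s _.
move=> [? [hna hnb]]; case: (ltgtP (u (t + e * s)) (u t)) => // hlt.
  by case: hnb; apply/rE.
by case: hna; apply/rE.
Qed.

(** If u is constant on one side of every point, then a point slightly on that
    side of t has on its other side a stretch where u is constant. *)
Let no_half_constant (e : R) (lt : rel R) : `|e| = 1 -> irreflexive lt ->
  germ0 (fun t => germ0 (fun s => u (t + e * s) = u t)) ->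
  ~ germ0 (fun t => germ0 (fun s => lt (u t) (u (t - e * s)))).
Proof.
move=> e1 irr ha hb; have [d d_gt0 hd] := germ0_and ha hb.
have [|[e2 e20 he2] _] := hd (d / 2); first by lra.
pose c := Num.min e2 (d / 2) / 2.
have c0 : 0 < c by rewrite divr_gt0// lt_min e20 divr_gt0.
have [ce cd] : c < e2 /\ c < d / 2.
  by split; rewrite ltr_pdivrMr// gt_min ltr_pMr ?ltr1n ?orbT// divr_gt0.
have := ler_norm (e * c); have := ler_norm (- (e * c)).
rewrite normrN normrM e1 mul1r gtr0_norm// => b1 b2.
have [|_ [e3 e30 he3]] := hd (d / 2 + e * c); first by lra.
pose s := Num.min e3 c / 2.
have s0 : 0 < s by rewrite divr_gt0// lt_min e30.
have [se sc] : s < e3 /\ s < c.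
  by split; rewrite ltr_pdivrMr// gt_min ltr_pMr ?ltr1n ?orbT.
have := he3 s; rewrite s0 se he2 ?c0// -addrA -mulrBr he2; first by rewrite irr => /(_ isT).
by lra.
Qed.

(** Of the nine combinations of a left and a right behaviour, two are strict local
    extrema at every point, four mix local constancy with strict variation,
    and the remaining three propagate from local to global. *)
Lemma monotone_germ : exists d, 0 < d <= d0 /\
  [\/ forall s t, 0 < s -> s < t -> t < d -> u s < u t,
      forall s t, 0 < s -> s < t -> t < d -> u t < u s |
      forall s t, 0 < s -> s < t -> t < d -> u s = u t].
Proof.
have fin (lt : R -> R -> Prop) : (forall x y z, lt x y -> lt y z -> lt x z) ->
    germ0 (fun t => germ0 (fun s => lt (u t) (u (t + 1 * s)))) ->
    germ0 (fun t => germ0 (fun s => lt (u (t + -1 * s)) (u t))) ->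
    exists d, 0 < d <= d0 /\
      forall s t, 0 < s -> s < t -> t < d -> lt (u s) (u t).
  move=> tr ha hb; have [d dp hd] := germ0_and ha hb.
  exists (Num.min d d0); split; first by rewrite lt_min dp d0_gt0 ge_min lexx orbT.
  apply: homo_of_local => // t /andP[t0]; rewrite lt_min => /andP[td _].
  have [|h1 h2] := hd t; first by rewrite t0.
  by split; [apply: germ0_imp h1|apply: germ0_imp h2] => s _;
    rewrite ?mul1r ?mulN1r.
have nh1 := @no_half_constant 1; have nh2 := @no_half_constant (-1).
rewrite !(normrN1, normr1) in nh1 nh2.
have noext (lt : rel R) : irreflexive lt -> (forall x y, lt x y -> ~~ lt y x) ->
    germ0 (fun t => germ0 (fun s => lt (u t) (u (t + 1 * s)))) ->
    ~ germ0 (fun t => germ0 (fun s => lt (u t) (u (t + -1 * s)))).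
  move=> irr asym ha hb; have [d dp hd] := germ0_and ha hb.
  apply: (@no_interval_of_strict_extrema u d lt) => // t /hd[h1 h2].
  have [e ep he] := germ0_and h1 h2; exists e => // s /he.
  by rewrite mul1r mulN1r.
have N1 (P : R -> R -> Prop) : germ0 (fun t => germ0 (fun s => P t (t + -1 * s))) ->
    germ0 (fun t => germ0 (fun s => P t (t - 1 * s))).
  apply: germ0_imp => t _; apply: germ0_imp => s _; by rewrite mulN1r mul1r.
have N2 (P : R -> R -> Prop) : germ0 (fun t => germ0 (fun s => P t (t + 1 * s))) ->
    germ0 (fun t => germ0 (fun s => P t (t - -1 * s))).
  apply: germ0_imp => t _; apply: germ0_imp => s _; by rewrite mulN1r opprK mul1r.
have asym1 (x y : R) : x < y -> ~~ (y < x) by case: ltgtP.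
have irr2 : irreflexive (fun x y : R => y < x) by move=> x; rewrite ltxx.
have [||] := @germ_trichotomy 1 (normr1 _) => hr;
  have [||] := @germ_trichotomy (-1) (normrN1 _) => hl.
- by case: (noext _ (@ltxx _ R) _ hr hl).
- have [d [dd hd]] := fin (fun x y => x < y) (fun x y z => @lt_trans _ _ y x z) hr hl.
  by exists d; split => //; constructor 1.
- by case: (nh2 _ erefl (@ltxx _ R) hl); apply: (N2 (fun t s => u t < u s)).
- have [|d [dd hd]] := fin (fun x y => y < x) _ hr hl.
    by move=> x y z yx zy; apply: lt_trans zy yx.
  by exists d; split => //; constructor 2.
- by case: (noext _ irr2 _ hr hl) => // x y; apply: asym1.
- by case: (nh2 _ erefl irr2 hl); apply: (N2 (fun t s => u s < u t)).
- by case: (nh1 _ erefl (@ltxx _ R) hr); apply: (N1 (fun t s => u t < u s)).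
- by case: (nh1 _ erefl irr2 hr); apply: (N1 (fun t s => u s < u t)).
have [|||d [dd hd]] := fin eq.
- by move=> x y z -> ->.
- by apply: germ0_imp hr => t _; apply: germ0_imp => s _ ->.
- by apply: germ0_imp hl => t _; apply: germ0_imp => s _ ->.
by exists d; split => //; constructor 3.
Qed.

End germ_of_function.
End monotonicity.

(** * The Frobenius norm *)

Section frobenius.
Variables (R : realType) (m n : nat).
Implicit Types X Y Z : 'M[R]_(m, n).

Lemma frob_dotE X Y : frob_dot X Y = \sum_ij X ij.1 ij.2 * Y ij.1 ij.2.
Proof.
rewrite /frob_dot /mxtrace -(pair_bigA _ (fun i j => X i j * Y i j)) exchange_big /=.
by apply: eq_bigr => j _; rewrite mxE; apply: eq_bigr => i _; rewrite mxE.
Qed.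

Lemma frob_dotC X Y : frob_dot X Y = frob_dot Y X.
Proof. by rewrite !frob_dotE; apply: eq_bigr => i _; rewrite mulrC. Qed.

Lemma frob_dotDl X Y Z : frob_dot (X + Y) Z = frob_dot X Z + frob_dot Y Z.
Proof. by rewrite /frob_dot raddfD /= mulmxDl raddfD. Qed.

Lemma frob_dotNl X Y : frob_dot (- X) Y = - frob_dot X Y.
Proof. by rewrite /frob_dot raddfN /= mulNmx raddfN. Qed.

Lemma frob_dotZl a X Y : frob_dot (a *: X) Y = a * frob_dot X Y.
Proof. by rewrite /frob_dot linearZ /= -scalemxAl linearZ. Qed.

Lemma frob_dotDr X Y Z : frob_dot Z (X + Y) = frob_dot Z X + frob_dot Z Y.
Proof. by rewrite frob_dotC frob_dotDl !(frob_dotC Z). Qed.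

Lemma frob_dotNr X Y : frob_dot X (- Y) = - frob_dot X Y.
Proof. by rewrite frob_dotC frob_dotNl frob_dotC. Qed.

Lemma frob_dotZr a X Y : frob_dot X (a *: Y) = a * frob_dot X Y.
Proof. by rewrite frob_dotC frob_dotZl frob_dotC. Qed.

Lemma frob_dot0l X : frob_dot 0 X = 0.
Proof. by rewrite -(scale0r X) frob_dotZl mul0r. Qed.

Lemma frob_dot0r X : frob_dot X 0 = 0.
Proof. by rewrite frob_dotC frob_dot0l. Qed.

Lemma frob_dot_ge0 X : 0 <= frob_dot X X.
Proof. by rewrite frob_dotE sumr_ge0 // => i _; rewrite -expr2 sqr_ge0. Qed.

Lemma frob_dot_eq0 X : frob_dot X X = 0 -> X = 0.
Proof.
rewrite frob_dotE => /eqP; rewrite psumr_eq0 => [/allP X0|i _]; last first.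
  by rewrite -expr2 sqr_ge0.
apply/matrixP => i j; have := X0 (i, j).
by rewrite mem_index_enum /= mulf_eq0 orbb mxE => /(_ isT)/eqP.
Qed.

Lemma sqr_frob_norm X : frob_norm X ^+ 2 = frob_dot X X.
Proof. by rewrite sqr_sqrtr // frob_dot_ge0. Qed.

Lemma frob_norm_ge0 X : 0 <= frob_norm X. Proof. exact: sqrtr_ge0. Qed.

Lemma frob_norm_eq0 X : frob_norm X = 0 -> X = 0.
Proof. by move=> X0; apply: frob_dot_eq0; rewrite -sqr_frob_norm X0 expr0n. Qed.

Lemma frob_norm0 : frob_norm (0 : 'M[R]_(m, n)) = 0.
Proof. by rewrite /frob_norm frob_dot0l sqrtr0. Qed.

Lemma frob_normN X : frob_norm (- X) = frob_norm X.
Proof. by rewrite /frob_norm frob_dotNl frob_dotNr opprK. Qed.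

Lemma frob_norm_distC X Y : frob_norm (X - Y) = frob_norm (Y - X).
Proof. by rewrite -frob_normN opprB. Qed.

Lemma frob_normZ a X : frob_norm (a *: X) = `|a| * frob_norm X.
Proof.
by rewrite /frob_norm frob_dotZl frob_dotZr mulrA -expr2 sqrtrM ?sqr_ge0// sqrtr_sqr.
Qed.

Lemma cauchy_schwarz X Y : frob_dot X Y <= frob_norm X * frob_norm Y.
Proof.
set a := frob_norm X; set b := frob_norm Y.
have a0 : 0 <= a by exact: frob_norm_ge0.
have b0 : 0 <= b by exact: frob_norm_ge0.
have [/frob_norm_eq0 X0|an] := eqVneq a 0; first by rewrite X0 frob_dot0l mulr_ge0.
have [/frob_norm_eq0 Y0|bn] := eqVneq b 0; first by rewrite Y0 frob_dot0r mulr_ge0.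
have ab : 0 < a * b by rewrite mulr_gt0// lt0r ?an ?bn.
have := frob_dot_ge0 (b *: X - a *: Y).
rewrite !(frob_dotDl, frob_dotDr, frob_dotNl, frob_dotNr, frob_dotZl, frob_dotZr).
rewrite (frob_dotC Y X) -!sqr_frob_norm -/a -/b => h.
rewrite -(ler_pM2l ab).
by lra.
Qed.

Lemma ler_frob_normD X Y : frob_norm (X + Y) <= frob_norm X + frob_norm Y.
Proof.
have h := addr_ge0 (frob_norm_ge0 X) (frob_norm_ge0 Y).
rewrite -(ler_pXn2r (n := 2)) ?nnegrE ?frob_norm_ge0//.
rewrite sqr_frob_norm !(frob_dotDl, frob_dotDr) (frob_dotC Y X) -!sqr_frob_norm.
have := cauchy_schwarz X Y; lra.
Qed.

Lemma entry_le_frob_norm X i j : `|X i j| <= frob_norm X.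
Proof.
rewrite -(ler_pXn2r (n := 2)) ?nnegrE ?frob_norm_ge0// sqr_frob_norm frob_dotE.
rewrite (bigD1 (i, j)) //= real_normK ?num_real// expr2 lerDl sumr_ge0//.
by move=> k _; rewrite -expr2 sqr_ge0.
Qed.

Lemma frob_norm_le_sum X : frob_norm X <= \sum_ij `|X ij.1 ij.2|.
Proof.
rewrite {1}(matrix_sum_delta X) pair_bigA /=.
apply: (@le_trans _ _ (\sum_ij frob_norm (X ij.1 ij.2 *: delta_mx ij.1 ij.2))).
  elim/big_ind2 : _ => [|A a B b Aa Bb|//]; first by rewrite frob_norm0.
  exact: le_trans (ler_frob_normD _ _) (lerD Aa Bb).
apply: ler_sum => -[i j] _ /=; rewrite frob_normZ -[leRHS]mulr1 ler_wpM2l//.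
rewrite /frob_norm frob_dotE (bigD1 (i, j)) //= big1 => [|[k l] /= kl].
  by rewrite !mxE !eqxx mulr1 addr0 sqrtr1.
rewrite !mxE; move: kl; rewrite xpair_eqE negb_and.
by case: (_ == i) (_ == j) => -[]; rewrite //= mul0r.
Qed.

Lemma continuous_frob_dot (T : topologicalType) (F : set_system T) {FF : Filter F}
    (f g : T -> 'M[R]_(m, n)) X Y :
  f x @[x --> F] --> X -> g x @[x --> F] --> Y ->
  frob_dot (f x) (g x) @[x --> F] --> frob_dot X Y.
Proof.
move=> fX gY; rewrite frob_dotE.
under [X in X @ _ --> _]funext do rewrite frob_dotE.
apply: (@cvg_big R _ +%R 0 xpredT _ T F) => [|ij _].
  move=> x; apply: cvgD; [exact: cvg_fst|exact: cvg_snd].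
have c (h : T -> 'M[R]_(m, n)) Z : h x @[x --> F] --> Z ->
    h x ij.1 ij.2 @[x --> F] --> Z ij.1 ij.2.
  by move=> hZ; exact: (cvg_comp h (fun M => M ij.1 ij.2) hZ (@coord_continuous _ m n _ _ Z)).
by apply: cvgM; apply: c.
Qed.

(** Matrices are homeomorphic to row vectors, where bounded closed sets are
    compact. *)
Lemma mx_bounded_closed_compact (A : set 'M[R]_(m, n)) (b : R) :
  (forall X, A X -> frob_norm X <= b) -> closed A -> compact A.
Proof.
move=> Ab Acl.
have cv : continuous (@vec_mx R m n).
  move=> x B /= /nbhs_ballP[e /= e0 eB]; apply/nbhs_ballP; exists e => //= y [_ xy].
  by apply: eB; split => // i j; rewrite !mxE.
have -> : A = @vec_mx R m n @` (@vec_mx R m n @^-1` A).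
  rewrite image_preimage //; apply/seteqP; split=> // X _.
  by exists (mxvec X); rewrite ?mxvecK.
apply: continuous_compact; first by move=> x; exact: continuous_subspaceT.
apply: bounded_closed_compact; last by apply: preimage_closed => // x _; exact: cv.
exists b; split; first exact: num_real.
move=> x bx v /= Av; apply: le_trans (ltW bx); apply: le_trans (Ab _ Av).
rewrite {1}/Num.norm /= mx_normrE; elim/big_ind : _ => [|y z hy hz|[i k] _].
- exact: frob_norm_ge0.
- by rewrite ge_max hy.
- rewrite /= ord1; case/mxvec_indexP: k => p q.
  by have := entry_le_frob_norm (vec_mx v) p q; rewrite mxE.
Qed.

Lemma frob_norm_continuous : continuous (fun X : 'M[R]_(m, n) => frob_norm X).
Proof.
move=> x; apply: (@cvg_comp _ _ _ (fun y => frob_dot y y) Num.sqrt _ (nbhs (frob_dot x x))).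
  by apply: (@continuous_frob_dot _ (nbhs x) _ id id); exact: cvg_id.
exact: sqrt_continuous.
Qed.

Lemma compact_frob_ball (b : R) : compact [set X : 'M[R]_(m, n) | frob_norm X <= b].
Proof.
apply: (@mx_bounded_closed_compact _ b) => //.
rewrite -[X in closed X]/((fun X : 'M[R]_(m, n) => frob_norm X) @^-1` [set y | y <= b]).
by apply: preimage_closed (@closed_le R b) => x _; exact: frob_norm_continuous.
Qed.

End frobenius.

(** * Definable selection by lexicographic minimization *)

Section lexicographic_minimum.
Variables (R : realType) (T : topologicalType).
Implicit Types (phi : T -> R) (s : seq (T -> R)) (K : set T).

Definition argmin_on phi K : set T :=
  [set z | K z /\ forall z', K z' -> phi z <= phi z'].

(** Minimizers of the first function of s, among them those of the second one,
    and so on. *)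
Fixpoint lexmin s K : set T :=
  if s is phi :: s' then lexmin s' (argmin_on phi K) else K.

Lemma lexmin_subset s K : lexmin s K `<=` K.
Proof. by elim: s K => [|phi s ih] K z /=; [|move=> /ih[]]. Qed.

Lemma lexmin_nonempty s K :
  (forall i, continuous (nth (fun=> 0) s i)) -> compact K -> K !=set0 ->
  lexmin s K !=set0.
Proof.
elim: s K => [//|phi s ih] K cs cK K0 /=; apply: ih; first by move=> i; apply: (cs i.+1).
  have cphi : continuous phi by exact: (cs 0%N).
  have -> : argmin_on phi K =
      K `&` \bigcap_(z' in K) [set z | phi z <= phi z'].
    by apply/seteqP; split=> z [Kz h]; split.
  apply: compact_closedI => //; apply: closed_bigI => z' _.
  exact: (closed_comp (fun x _ => cphi x) (@closed_le R (phi z'))).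
have [|c cK' hc] := @compact_EVT_min T R phi K K0 cK.
  by apply: continuous_subspaceT; exact: (cs 0%N).
exists c; split; first by rewrite inE in cK'.
by move=> z' Kz'; apply: hc; rewrite inE.
Qed.

(** All lexicographic minimizers have the same values, so that a choice among them
    does not affect these values: this makes the selection definable. *)
Lemma lexmin_eq s K z z' i : lexmin s K z -> lexmin s K z' -> (i < size s)%N ->
  nth (fun=> 0) s i z = nth (fun=> 0) s i z'.
Proof.
elim: s K i => [//|phi s ih] K [|i] hz hz' /=; last by rewrite ltnS; apply: ih hz hz'.
have [Kz h] : argmin_on phi K z by exact: (@lexmin_subset s _ z hz).
have [Kz' h'] : argmin_on phi K z' by exact: (@lexmin_subset s _ z' hz').
by move=> _; apply/le_anti/andP; split; [apply: h|apply: h'].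
Qed.
End lexicographic_minimum.

Section definable_matrices.
Variables (R : realType) (m n : nat).

Definition polyfun_mx (C : Type) (cs : seq (C -> R)) (x : C -> 'M[R]_(m, n)) :=
  forall i j, polyfun cs (fun c => x c i j).

Lemma polyfun_frob_dot (C : Type) (cs : seq (C -> R)) x y :
  polyfun_mx cs x -> polyfun_mx cs y -> polyfun cs (fun c => frob_dot (x c) (y c)).
Proof.
move=> hx hy; apply: (polyfun_ext (fun c => esym (frob_dotE (x c) (y c)))).
by apply: polyfun_sum => ij; apply: polyfunM.
Qed.

Lemma polyfun_mxB (C : Type) (cs : seq (C -> R)) x y :
  polyfun_mx cs x -> polyfun_mx cs y -> polyfun_mx cs (fun c => x c - y c).
Proof.
move=> hx hy i j; apply: (@polyfun_ext _ _ _ (fun c => x c i j - y c i j)).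
  by move=> c; rewrite !mxE.
exact: polyfunB.
Qed.

Lemma definable_graph (Psi : 'M[R]_(m, n) -> \bar R) : semialgebraic_fun Psi ->
  forall (C : Type) (cs : seq (C -> R)) x v,
  polyfun_mx cs x -> polyfun cs v ->
  definable cs (fun c => Psi (x c) = (v c)%:E).
Proof.
move=> hPsi C cs x v hx hv.
have hrow i : polyfun cs (fun c => row_mx (mxvec (x c)) (v c)%:M ord0 i : R).
  case: (split_ordP i) => k -> {i}.
    case/mxvec_indexP: k => i j; apply: (polyfun_ext _ (hx i j)) => c.
    by rewrite row_mxEl mxvecE.
  apply: (polyfun_ext _ hv) => c.
  by rewrite row_mxEr !ord1 mxE eqxx mulr1n.
have [f rf fP] := definable_semialgebraic hPsi hrow.
exists f => // c; rewrite fP /=; split=> [[[y w] /= yw /eq_row_mx[]]|xv].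
  move=> /(can_inj mxvecK) <- /matrixP/(_ ord0 ord0).
  by rewrite !mxE eqxx !mulr1n => <-.
by exists (x c, v c).
Qed.
End definable_matrices.

(** * The desingularizing function *)

Section desingularization.
Variables (R : realType) (m n : nat) (Psi : 'M[R]_(m, n) -> \bar R).
Variables (B rho v0 : R).
Local Notation T := ('M[R]_(m, n) * 'M[R]_(m, n))%type.

(** The pairs of a point x of the ball at level v0 + t and of a small subgradient
    w of Psi at x, up to an error rho |y - x|^2. The condition only mentions
    finite values of Psi, hence only its graph, which is what is semialgebraic. *)
Definition level_subgradients (t : R) : set T :=
  [set z | [/\ frob_dot z.1 z.1 <= B, frob_dot z.2 z.2 <= 1,
    Psi z.1 = (v0 + t)%:E & forall y v, frob_dot y y <= B -> Psi y = v%:E ->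
      v0 + t + frob_dot z.2 (y - z.1) - rho * frob_dot (y - z.1) (y - z.1) <= v]].

(** Their values determine x and the norm of w. *)
Definition selectors : seq (T -> R) :=
  (fun z => frob_dot z.2 z.2) ::
  [seq (fun z : T => z.1 ij.1 ij.2) | ij <- enum [set: 'I_m * 'I_n]%SET].

Hypothesis Psi_semialg : semialgebraic_fun Psi.
Hypothesis Psi_ninfty : forall X, Psi X != -oo%E.
Hypothesis Psi_closed : closed [set p : 'M[R]_(m, n) * R | (Psi p.1 <= p.2%:E)%E].

Definition definable_family (K : R -> set T) : Prop :=
  forall (C : Type) (cs : seq (C -> R)) a x w,
  polyfun cs a -> polyfun_mx cs x -> polyfun_mx cs w ->
  definable cs (fun c => K (a c) (x c, w c)).

Lemma polyfun_mx_fst_mx (C : Type) (cs : seq (C -> R)) p q (x : C -> 'M[R]_(p, q)) :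
  polyfun_mx cs x -> polyfun_mx (ext_coords_mx m n cs) (fun c => x c.1).
Proof. by move=> hx i j; apply: (polyfun_fst_mx _ _ (hx i j)). Qed.

Lemma polyfun_mx_snd_mx (C : Type) (cs : seq (C -> R)) :
  polyfun_mx (ext_coords_mx m n cs) (fun c => c.2).
Proof. by move=> i j; apply: polyfun_snd_mx. Qed.

Lemma polyfun_mx_fst (C : Type) (cs : seq (C -> R)) p q (x : C -> 'M[R]_(p, q)) :
  polyfun_mx cs x -> polyfun_mx (ext_coords cs) (fun c => x c.1).
Proof. by move=> hx i j; apply: (polyfun_fst (hx i j)). Qed.

Lemma definable_level_subgradients : definable_family level_subgradients.
Proof.
move=> C cs a x w ha hx hw.
apply: (@definable_ext _ _ _ (fun c => (frob_dot (x c) (x c) <= B /\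
  frob_dot (w c) (w c) <= 1) /\ (Psi (x c) = (v0 + a c)%:E /\
  forall y v, frob_dot y y <= B /\ Psi y = v%:E ->
    v0 + a c + frob_dot (w c) (y - x c) - rho * frob_dot (y - x c) (y - x c) <= v))).
  move=> c; split=> [[[? ?] [? h]]|[? ? ? h]]; do ?split=> //.
    by move=> y v ? ?; apply: h.
  by move=> y v []; apply: h.
have v0a : polyfun cs (fun c => v0 + a c).
  by apply: polyfunD => //; apply: polyfun_cst.
apply: definable_and.
  by apply: definable_and; apply: definable_le; try exact: polyfun_cst;
    apply: polyfun_frob_dot.
apply: definable_and; first exact: definable_graph.
apply: definable_all_mx; apply: definable_all_real.
have hx' := polyfun_mx_fst (polyfun_mx_fst_mx hx).
have hw' := polyfun_mx_fst (polyfun_mx_fst_mx hw).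
have hy := polyfun_mx_fst (@polyfun_mx_snd_mx C cs).
have hyx := polyfun_mxB hy hx'.
have hv := polyfun_snd (ext_coords_mx m n cs).
apply: definable_imp.
  apply: definable_and; last exact: definable_graph.
  by apply: definable_le; [exact: polyfun_frob_dot|exact: polyfun_cst].
apply: definable_le => //; apply: polyfunB; last first.
  by apply: polyfunM; [exact: polyfun_cst|exact: polyfun_frob_dot].
apply: polyfunD; last exact: polyfun_frob_dot.
exact: (polyfun_fst (polyfun_fst_mx m n v0a)).
Qed.

Lemma definable_lexmin (s : seq (T -> R)) (K : R -> set T) :
  (forall i (C : Type) (cs : seq (C -> R)) x w,
    polyfun_mx cs x -> polyfun_mx cs w ->
    polyfun cs (fun c => nth (fun=> 0) s i (x c, w c))) ->
  definable_family K -> definable_family (fun t => lexmin s (K t)).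
Proof.
elim: s K => [//|phi s ih] K hs hK; apply: ih => [i|]; first exact: (hs i.+1).
have hphi := hs 0%N.
move=> C cs a x w ha hx hw; apply: definable_and; first exact: hK.
apply: (@definable_ext _ _ _ (fun c => forall x' w', K (a c) (x', w') ->
    phi (x c, w c) <= phi (x', w'))) => [c|].
  by split=> [h [x' w']|h x' w']; apply: h.
have hx' := @polyfun_mx_fst_mx _ _ _ _ _ (@polyfun_mx_snd_mx C cs).
have hw' := @polyfun_mx_snd_mx _ (ext_coords_mx m n cs).
apply: definable_all_mx; apply: definable_all_mx; apply: definable_imp.
  by apply: hK => //; exact: (polyfun_fst_mx m n (polyfun_fst_mx m n ha)).
apply: definable_le; last exact: hphi.
by apply: hphi; exact: polyfun_mx_fst_mx (polyfun_mx_fst_mx _).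
Qed.

Lemma polyfun_selectors i (C : Type) (cs : seq (C -> R)) x w :
  polyfun_mx cs x -> polyfun_mx cs w ->
  polyfun cs (fun c => nth (fun=> 0) selectors i (x c, w c)).
Proof.
move=> hx hw; case: i => [|i] /=; first exact: polyfun_frob_dot.
have [ilt|ige] := ltnP i (size (enum [set: 'I_m * 'I_n]%SET)); last first.
  by rewrite nth_default ?size_map//; exact: polyfun_cst.
case: (enum _) ilt => [//|ij0 e] ilt.
by rewrite (nth_map ij0).
Qed.

Lemma continuous_selectors i : continuous (nth (fun=> 0) selectors i).
Proof.
case: i => [|i] /=.
  by move=> z; apply: continuous_frob_dot; exact: cvg_snd.
have [ilt|ige] := ltnP i (size (enum [set: 'I_m * 'I_n]%SET)); last first.
  by rewrite nth_default ?size_map//; move=> z; exact: cvg_cst.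
case: (enum _) ilt => [//|ij0 e] ilt.
rewrite (nth_map ij0) // => z.
exact: (cvg_comp fst (fun M : 'M[R]_(m, n) => M _ _) cvg_fst (@coord_continuous _ m n _ _ z.1)).
Qed.

(** The point is that Psi z.1 = v0 + t survives limits although Psi is only lower
    semicontinuous: the limit has value at most v0 + t, and then the
    subgradient inequality at y = z.1 gives the reverse inequality. *)
Lemma compact_level_subgradients t : compact (level_subgradients t).
Proof.
pose ball (b : R) := [set x : 'M[R]_(m, n) | frob_dot x x <= b].
have cfd : continuous (fun x : 'M[R]_(m, n) => frob_dot x x).
  by move=> x; apply: (@continuous_frob_dot R m n _ (nbhs x) _ id id); exact: cvg_id.
have cball b : closed (ball b).
  exact: (closed_comp (fun x _ => cfd x) (@closed_le R b)).
have kball b : compact (ball b).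
  apply: (@mx_bounded_closed_compact _ _ _ _ (Num.sqrt b)) => // x xb.
  exact: ler_wsqrtr.
apply: (@subclosed_compact _ _ (ball B `*` ball 1)); last first.
- by move=> z [? ? _ _].
- exact: compact_setX.
pose D := [set p : 'M[R]_(m, n) * R | frob_dot p.1 p.1 <= B /\ Psi p.1 = p.2%:E].
have -> : level_subgradients t = (ball B `*` ball 1) `&`
   [set z | (Psi z.1 <= (v0 + t)%:E)%E] `&`
   \bigcap_(p in D) [set z | v0 + t + frob_dot z.2 (p.1 - z.1)
      - rho * frob_dot (p.1 - z.1) (p.1 - z.1) <= p.2].
  apply/seteqP; split=> z /=.
    by move=> [h1 h2 h3 h4]; split; [split=> //; rewrite h3|move=> [y v] [/= ? ?]; apply: h4].
  move=> [[[h1 h2] h3] h4].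
  have h5 y v : frob_dot y y <= B -> Psi y = v%:E -> v0 + t + frob_dot z.2 (y - z.1)
     - rho * frob_dot (y - z.1) (y - z.1) <= v by move=> yB yv; apply: (h4 (y, v)).
  split=> //; move: h3 (@Psi_ninfty z.1) (h5 z.1) h1.
  case: (Psi z.1) => [v| |] //= h3 _ /(_ v) + h1.
  rewrite subrr !frob_dot0r mulr0 subr0 addr0 => /(_ h1 erefl) h6.
  by congr EFin; apply/le_anti; rewrite h6 -lee_fin h3.
apply: closedI; first apply: closedI.
- have -> : ball B `*` ball 1 = fst @^-1` (ball B) `&` snd @^-1` (ball 1) :> set T by [].
  apply: closedI; apply: preimage_closed => // z _; [exact: cvg_fst|exact: cvg_snd].
- apply: (closed_comp (f := fun z : T => (z.1, v0 + t)) _ Psi_closed) => z _.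
  exact: (@cvg_pair T _ _ (nbhs z) (nbhs z.1) (nbhs (v0 + t)) _ _ _ fst (fun=> v0 + t) cvg_fst (@cvg_cst _ _ _ _ _)).
apply: closed_bigI => p _.
apply: (closed_comp (f := fun z : T => _) _ (@closed_le R p.2)) => z _.
have cp : p.1 - z'.1 @[z' --> z] --> p.1 - z.1.
  by apply: cvgB; [exact: cvg_cst|exact: cvg_fst].
apply: cvgB; last by apply: cvgM; [exact: cvg_cst|exact: continuous_frob_dot].
apply: cvgD; first exact: cvg_cst.
by apply: continuous_frob_dot => //; exact: cvg_snd.
Qed.

(** Each selector takes a single value on the definable set of lexicographic
    minimizers at t; this value is thus a definable function of t, to which
    [monotone_germ] applies. *)
Lemma monotone_selection (d0 : R) : 0 < d0 ->
  (forall t, 0 < t < d0 -> level_subgradients t !=set0) ->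
  exists2 gamma : R -> T, (forall t, 0 < t < d0 -> level_subgradients t (gamma t) /\
    forall z, level_subgradients t z -> frob_dot (gamma t).2 (gamma t).2 <= frob_dot z.2 z.2) &
  exists d, 0 < d <= d0 /\ forall i, (i < size selectors)%N ->
    let u t := nth (fun=> 0) selectors i (gamma t) in
  [\/ forall s t, 0 < s -> s < t -> t < d -> u s < u t,
      forall s t, 0 < s -> s < t -> t < d -> u t < u s |
      forall s t, 0 < s -> s < t -> t < d -> u s = u t].
Proof.
move=> d00 hne.
pose L t := lexmin selectors (level_subgradients t).
have L0 t : 0 < t < d0 -> L t !=set0.
  move=> td; apply: lexmin_nonempty; last exact: hne.
    exact: continuous_selectors.
  exact: compact_level_subgradients.
pose gamma t := xget (0, 0) (L t).
have gP t : 0 < t < d0 -> L t (gamma t).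
  by move=> /L0[z Lz]; apply: xgetPex; exists z.
exists gamma.
  move=> t /gP Lt; split; first exact: lexmin_subset Lt.
  have [_ h] : argmin_on (fun z : T => frob_dot z.2 z.2) (level_subgradients t) (gamma t).
    exact: (@lexmin_subset _ _ (behead selectors)).
  by move=> z; apply: h.
have hdef := definable_lexmin polyfun_selectors definable_level_subgradients.
have key i : (i < size selectors)%N ->
    let u t := nth (fun=> 0) selectors i (gamma t) in
    exists d, 0 < d <= d0 /\
  [\/ forall s t, 0 < s -> s < t -> t < d -> u s < u t,
      forall s t, 0 < s -> s < t -> t < d -> u t < u s |
      forall s t, 0 < s -> s < t -> t < d -> u s = u t].
  move=> isz u.
  pose r s t := exists x w x' w', L s (x, w) /\ L t (x', w') /\
     nth (fun=> 0) selectors i (x, w) < nth (fun=> 0) selectors i (x', w').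
  apply: (@monotone_germ R u r d0) => // [|s t sd td]; last first.
    split=> [[x [w [x' [w' [Ls [Lt]]]]]]|ust].
      by rewrite (lexmin_eq Ls (gP _ sd) isz) (lexmin_eq Lt (gP _ td) isz).
    exists (gamma s).1, (gamma s).2, (gamma t).1, (gamma t).2.
    by rewrite -!surjective_pairing; split; [apply: gP|split; [apply: gP|]].
  move=> C cs a b ha hb.
  do 4 apply: definable_ex_mx.
  pose c1 := ext_coords_mx m n cs; pose c2 := ext_coords_mx m n c1.
  pose c3 := ext_coords_mx m n c2.
  have w4 (p : C -> R) : polyfun cs p ->
      polyfun (ext_coords_mx m n c3) (fun c => p c.1.1.1.1).
    move=> hp; exact: (polyfun_fst_mx m n (polyfun_fst_mx m n (polyfun_fst_mx m n
      (polyfun_fst_mx m n hp)))).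
  have hw' := @polyfun_mx_snd_mx _ c3.
  have hx' := polyfun_mx_fst_mx (@polyfun_mx_snd_mx _ c2).
  have hw := polyfun_mx_fst_mx (polyfun_mx_fst_mx (@polyfun_mx_snd_mx _ c1)).
  have hx := polyfun_mx_fst_mx (polyfun_mx_fst_mx (polyfun_mx_fst_mx (@polyfun_mx_snd_mx _ cs))).
  apply: definable_and; first by apply: hdef => //; apply: w4.
  apply: definable_and; first by apply: hdef => //; apply: w4.
  by apply: definable_lt; apply: polyfun_selectors.
elim: (size selectors) key => [|k ih] key; first by exists d0; rewrite d00 lexx.
have [d1 [/andP[d10 d1d] h1]] := ih (fun i ik => key i (ltnW ik)).
have [d2 [/andP[d20 d2d] h2]] := key k (ltnSn k).
exists (Num.min d1 d2); split; first by rewrite lt_min d10 d20 ge_min d1d.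
have w (P : R -> R -> Prop) d d' : d <= d' ->
    (forall s t, 0 < s -> s < t -> t < d' -> P s t) ->
    (forall s t, 0 < s -> s < t -> t < d -> P s t).
  by move=> dd' h s t s0 st td; apply: h => //; apply: lt_le_trans td dd'.
move=> i; rewrite ltnS leq_eqVlt => /predU1P[->|ik] u.
  have /w w2 : Num.min d1 d2 <= d2 by rewrite ge_min lexx orbT.
  by case: h2 => h2; [constructor 1|constructor 2|constructor 3]; exact: w2 h2.
have /w w1 : Num.min d1 d2 <= d1 by rewrite ge_min lexx.
by case: (h1 i ik) => h; [constructor 1|constructor 2|constructor 3]; exact: w1 h.
Qed.

Hypothesis rho_ge0 : 0 <= rho.

(** Once y - x <= eta * kap the quadratic term is harmless: if the increment V of
    phi is at most kap, then rho * V is absorbed by eta - om, and otherwise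
    eta * V exceeds y - x anyway. So jumps of phi do no harm, and the local
    inequality propagates. *)
Lemma lipschitz_of_quadratic (phi : R -> R) (om eta s t : R) :
  0 <= om -> om < eta -> s < t ->
  (forall x y, s <= x -> x < y -> y <= t -> phi x <= phi y /\
     y - x <= om * (phi y - phi x) + rho * (phi y - phi x) ^+ 2) ->
  t - s <= eta * (phi t - phi s).
Proof.
move=> om0 ometa st H.
pose kap := (eta - om) / (rho + 1).
have kap0 : 0 < kap by rewrite divr_gt0 ?subr_gt0// ltr_wpDl.
have ek0 : 0 < eta * kap by rewrite mulr_gt0// (le_lt_trans om0).
have loc x y : s <= x -> x < y -> y <= t -> y - x < eta * kap ->
    y - x <= eta * (phi y - phi x).
  move=> sx xy yt yx; have [] := H x y sx xy yt.
  rewrite -subr_ge0; set V := phi y - phi x => V0 hV.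
  have [Vk|kV] := leP V kap; last first.
    by apply: le_trans (ltW yx) _; rewrite ler_pM2l ?(ltW kV)// (le_lt_trans om0).
  apply: le_trans hV _; rewrite expr2 mulrA -mulrDl ler_wpM2r// -lerBrDl.
  apply: le_trans (_ : rho * kap <= _); first by rewrite ler_wpM2l.
  rewrite /kap mulrCA ler_piMr ?subr_ge0 ?(ltW ometa)//.
  by rewrite ler_pdivrMr ?ltr_wpDl// mul1r lerDl.
apply: (@interval_induction R (fun x y => y - x <= eta * (phi y - phi x))) => //.
- by move=> x y z _ _ _ _ h1 h2; lra.
- move=> x /andP[sx xt]; exists (eta * kap) => // y /andP[xy yx] yt.
  by apply: loc => //; rewrite ltrBlDl.
- move=> y /andP[sy yt]; exists (eta * kap) => // x /andP[yx xy] sx.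
  by apply: loc => //; rewrite ltrBlDl -ltrBlDr.
Qed.

(** If no level close to v0 carries a small subgradient, phi = 0 does; if the
    minimal norm of the subgradients decreases with t, it is bounded below and
    a linear phi does. Otherwise the minimal norm at t dominates those at the
    levels below t, and [lipschitz_of_quadratic] applies on the interval from
    s to t. *)
Lemma desingularization : exists d, exists c, exists2 phi : R -> R,
  0 < d & forall s t, 0 < s -> s < t -> t < d ->
    [/\ `|phi s| <= c, `|phi t| <= c, phi s <= phi t &
     forall x w, level_subgradients t (x, w) -> t - s <= frob_norm w * (phi t - phi s)].
Proof.
have pid := @polyfun_id R.
have : definable [:: id] (fun t : R => exists x w, level_subgradients t (x, w)).
  apply: definable_ex_mx; apply: definable_ex_mx; apply: definable_level_subgradients.
  - exact: (polyfun_fst_mx m n (polyfun_fst_mx m n pid)).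
  - exact: (polyfun_mx_fst_mx (@polyfun_mx_snd_mx _ _)).
  - exact: polyfun_mx_snd_mx.
case/definable_germ0 => -[d0 d00 hd0]; last first.
  exists d0, 0, (fun=> 0) => // s t s0 st td; rewrite normr0; split => // x w h.
  by case: (hd0 t); [rewrite (lt_trans s0 st)|exists x, w].
have hne t : 0 < t < d0 -> level_subgradients t !=set0.
  by move=> /hd0[x [w h]]; exists (x, w).
have [gamma gP [d [/andP[dgt0 dd0] mono]]] := monotone_selection d00 hne.
have omP t z : 0 < t < d -> level_subgradients t z -> frob_norm (gamma t).2 <= frob_norm z.2.
  move=> /andP[t0 td] hz; apply: ler_wsqrtr; apply: (gP t _).2 => //.
  by rewrite t0 (lt_le_trans td).
have [mono0|nmono0] := pselect (forall s t, 0 < s -> s < t -> t < d ->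
    frob_norm (gamma s).2 <= frob_norm (gamma t).2); last first.
  have dec s t : 0 < s -> s < t -> t < d ->
      frob_dot (gamma t).2 (gamma t).2 < frob_dot (gamma s).2 (gamma s).2.
    have [/= h|/= h|/= h] := mono 0%N isT; last 2 first.
    - exact: h.
    - by case: nmono0 => s' t' s0 st td; rewrite /frob_norm (h s' t').
    by case: nmono0 => s' t' s0 st td; rewrite ler_wsqrtr// ltW// h.
  (* Strict decrease makes the norm positive at d / 2, not only nonnegative. *)
  pose c := frob_norm (gamma (d / 2)).2.
  have c0 : 0 < c.
    rewrite sqrtr_gt0; apply: le_lt_trans (frob_dot_ge0 _) (dec _ (d / 2 + d / 4) _ _ _); lra.
  exists (d / 2), (d / 2 / c), (fun t => t / c); first by rewrite divr_gt0.
  move=> s t s0 st td; have t0 := lt_trans s0 st; split.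
  - by rewrite ger0_norm ?divr_ge0 ?ler_pM2r ?invr_gt0//; lra.
  - by rewrite ger0_norm ?divr_ge0 ?ler_pM2r ?invr_gt0//; lra.
  - by rewrite ler_pM2r ?invr_gt0// ltW.
  move=> x w h; rewrite -mulrBl mulrCA ler_peMr ?subr_ge0 ?(ltW st)//.
  rewrite ler_pdivlMr// mul1r; apply: le_trans (omP t _ _ h); last by rewrite t0/=; lra.
  by apply: ler_wsqrtr; apply: ltW; apply: dec => //; lra.
have mono_ij (ij : 'I_m * 'I_n) : exists sg : R, `|sg| = 1 /\
    forall s t, 0 < s -> s < t -> t < d ->
      sg * ((gamma t).1 ij.1 ij.2 - (gamma s).1 ij.1 ij.2) =
      `|(gamma t).1 ij.1 ij.2 - (gamma s).1 ij.1 ij.2|.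
  have ijin : ij \in enum [set: 'I_m * 'I_n]%SET by rewrite mem_enum inE.
  have idx : (index ij (enum [set: 'I_m * 'I_n]%SET) < size (enum [set: 'I_m * 'I_n]%SET))%N.
    by rewrite index_mem.
  have := mono (index ij (enum [set: 'I_m * 'I_n]%SET)).+1.
  rewrite /= size_map ltnS => /(_ idx); rewrite (nth_map ij) // nth_index//.
  case=> h.
  - exists 1; split => [|s t s0 st td]; rewrite ?normr1// mul1r gtr0_norm//.
    by rewrite subr_gt0 h.
  - exists (-1); split => [|s t s0 st td]; rewrite ?normrN1// mulN1r ltr0_norm//.
    by rewrite subr_lt0 h.
  - exists 1; split => [|s t s0 st td]; rewrite ?normr1// mul1r ger0_norm//.
    by rewrite subr_ge0 (h s t).
have [sg sgP] := choice mono_ij.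
(* The signs make each term nondecreasing, so that no increment is lost. *)
pose phi t := \sum_ij sg ij * (gamma t).1 ij.1 ij.2.
have phiB s t : 0 < s -> s < t -> t < d ->
    phi t - phi s = \sum_ij `|((gamma t).1 - (gamma s).1) ij.1 ij.2|.
  move=> s0 st td; rewrite /phi -sumrB; apply: eq_bigr => ij _.
  by rewrite -mulrBr !mxE (sgP ij).2.
have phi_mono s t : 0 < s -> s < t -> t < d -> phi s <= phi t.
  by move=> s0 st td; rewrite -subr_ge0 phiB// sumr_ge0.
have critP t : 0 < t < d -> level_subgradients t (gamma t).
  by move=> /andP[t0 td]; apply: (gP t _).1; rewrite t0 (lt_le_trans td).
pose c : R := \sum_(ij : 'I_m * 'I_n) Num.sqrt B.
have phi_c t : 0 < t < d -> `|phi t| <= c.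
  move=> /critP[tB _ _ _]; apply: le_trans (ler_norm_sum _ _ _) _.
  apply: ler_sum => ij _; rewrite normrM (sgP ij).1 mul1r.
  by apply: le_trans (entry_le_frob_norm _ _ _) _; apply: ler_wsqrtr.
exists d, c, phi => // s t s0 st td.
have t0 := lt_trans s0 st; have sd := lt_trans st td.
split; [by apply: phi_c; rewrite s0|by apply: phi_c; rewrite t0|exact: phi_mono|].
move=> x w hw.
suff H eta : frob_norm (gamma t).2 < eta -> t - s <= eta * (phi t - phi s).
  apply: le_trans (_ : frob_norm (gamma t).2 * (phi t - phi s) <= _); last first.
    rewrite ler_wpM2r ?subr_ge0 ?phi_mono//.
    by apply: (omP t _ _ hw); rewrite t0.
  apply/ler_addgt0Pr => e e0.
  have V0 : 0 <= phi t - phi s by rewrite subr_ge0 phi_mono.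
  apply: le_trans (H (frob_norm (gamma t).2 + e / (phi t - phi s + 1)) _) _.
    by rewrite ltrDl divr_gt0// ltr_wpDl.
  rewrite mulrDl lerD2l mulrAC -mulrA ler_piMr ?(ltW e0)//.
  by rewrite ler_pdivrMr ?ltr_wpDl// mul1r lerDl.
move=> etaP; apply: (lipschitz_of_quadratic (frob_norm_ge0 _) etaP st) => y z sy yz zt.
have y0 := lt_le_trans s0 sy; have zd := le_lt_trans zt td.
have z0 := lt_trans y0 yz; have yd := lt_trans yz zd.
have phyz := phi_mono _ _ y0 yz zd; split => //.
set V := phi z - phi y.
have V0 : 0 <= V by rewrite subr_ge0.
have NV : frob_norm ((gamma z).1 - (gamma y).1) <= V.
  by rewrite /V phiB//; apply: frob_norm_le_sum.
have [|yB _ Py _] := critP y; first by rewrite y0.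
have [|_ _ _ /(_ _ _ yB Py) hz] := critP z; first by rewrite z0.
have omzt : frob_norm (gamma z).2 <= frob_norm (gamma t).2.
  move: zt; rewrite le_eqVlt => /predU1P[-> //|zt]; exact: mono0.
set D := (gamma z).1 - (gamma y).1 in NV.
have E : (gamma y).1 - (gamma z).1 = - D by rewrite /D opprB.
rewrite E frob_dotNl !frob_dotNr opprK -sqr_frob_norm in hz.
have h1 : frob_dot (gamma z).2 D <= frob_norm (gamma t).2 * V.
  apply: le_trans (cauchy_schwarz _ _) _.
  by apply: ler_pM => //; apply: frob_norm_ge0.
have h2 : rho * frob_norm D ^+ 2 <= rho * V ^+ 2.
  by rewrite ler_wpM2l// ler_sqr ?nnegrE ?frob_norm_ge0.
lra.
Qed.
End desingularization.

(** * First-order estimates along segments *)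

Section calculus.
Variables (R : realType) (m n : nat).
Implicit Types (h : 'M[R]_(m, n) -> R) (X Y V : 'M[R]_(m, n)).


Lemma is_derive_line h X V (t : R) : (forall Y, differentiable h Y) ->
  is_derive t 1 (fun s : R => h (X + s *: V)) (frob_dot (grad h (X + t *: V)) V).
Proof.
move=> dh; have E : (fun e : R => e^-1 *: (((fun s : R => h (X + s *: V)) \o shift t) (e *: 1)
    - h (X + t *: V))) =
    (fun e : R => e^-1 *: ((h \o shift (X + t *: V)) (e *: V) - h (X + t *: V))).
  apply/funext => e /=; congr (_ *: (h _ - _)).
  by rewrite scalerDl -[e *: 1]/(e * 1) mulr1 addrCA addrC.
split; first by rewrite /derivable /= E; exact: diff_derivable.
by rewrite /derive E -/(derive h _ V) deriveE// frob_dot_grad.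
Qed.

Lemma line_continuous h X V : (forall Y, differentiable h Y) ->
  {within `[(0 : R), 1], continuous (fun s : R => h (X + s *: V))}.
Proof.
move=> dh; apply: derivable_within_continuous => t _.
by have [] := is_derive_line X V t dh.
Qed.

Lemma gradient_mvt h X Y : (forall Y, differentiable h Y) ->
  exists2 t : R, 0 < t < 1 &
    h Y - h X = frob_dot (grad h (X + t *: (Y - X))) (Y - X).
Proof.
move=> dh.
have [t] := MVT ltr01 (fun t _ => is_derive_line X (Y - X) t dh) (line_continuous dh).
rewrite in_itv /= => t01; rewrite scale1r scale0r addr0 subrKC subr0 mulr1 => E.
by exists t.
Qed.

Lemma frob_norm_segment b X Y (t : R) : 0 <= t <= 1 ->
  frob_norm X <= b -> frob_norm Y <= b -> frob_norm (X + t *: (Y - X)) <= b.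
Proof.
move=> /andP[t0 t1] Xb Yb.
have -> : X + t *: (Y - X) = (1 - t) *: X + t *: Y.
  by rewrite scalerBl scale1r scalerBr addrA addrAC.
apply: le_trans (ler_frob_normD _ _) _; rewrite !frob_normZ !ger0_norm ?subr_ge0//.
have -> : b = (1 - t) * b + t * b by rewrite -mulrDl subrK mul1r.
by rewrite lerD// ler_wpM2l ?subr_ge0.
Qed.

Lemma first_order_error h (b K : R) X Y : (forall Y, differentiable h Y) -> 0 <= K ->
  (forall X Y, frob_norm X <= b -> frob_norm Y <= b ->
     frob_norm (grad h X - grad h Y) <= K * frob_norm (X - Y)) ->
  frob_norm X <= b -> frob_norm Y <= b ->
  h X + frob_dot (grad h X) (Y - X) - K * frob_dot (Y - X) (Y - X) <= h Y.
Proof.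
move=> dh K0 Klip Xb Yb; have [t /andP[t0 t1] E] := gradient_mvt X Y dh.
set Z := X + t *: (Y - X) in E.
have Zb : frob_norm Z <= b by apply: frob_norm_segment; rewrite // (ltW t0) ltW.
have := Klip _ _ Xb Zb; rewrite frob_norm_distC.
have -> : X - Z = - (t *: (Y - X)) by rewrite /Z opprD addrA subrr add0r.
rewrite frob_normN frob_normZ gtr0_norm// => h1.
have h2 := cauchy_schwarz (grad h X - grad h Z) (Y - X).
rewrite frob_norm_distC frob_dotDl frob_dotNl -E in h2.
set N := frob_norm (Y - X) in h1 h2.
have N0 : 0 <= N by exact: frob_norm_ge0.
rewrite -sqr_frob_norm -/N.
have h3 : frob_norm (grad h Z - grad h X) * N <= K * N ^+ 2.
  rewrite expr2 mulrA ler_wpM2r//; apply: le_trans h1 _.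
  by rewrite ler_wpM2l// ler_piMl// ltW.
lra.
Qed.

(** Subtract from h on the segment its first-order part and sigma / 2 |V|^2 t^2:
    strong convexity says that the derivative of what remains is nonnegative. *)
Lemma bregman_lower_bound h (sigma : R) X Y : (forall Y, differentiable h Y) ->
  strongly_convex sigma h ->
  sigma / 2 * frob_dot (X - Y) (X - Y) <= bregman h X Y.
Proof.
move=> dh hsc; set V := X - Y.
pose q (t : R) := h (Y + t *: V) + (- (frob_dot (grad h Y) V) * t + - (sigma / 2 * frob_dot V V) * t ^+ 2).
pose dq (t : R) := frob_dot (grad h (Y + t *: V)) V + (- (frob_dot (grad h Y) V) + - (sigma / 2 * frob_dot V V) * (t *+ 2)).
have hq (t : R) : is_derive t 1 q (dq t).
  apply: is_deriveD; first exact: is_derive_line.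
  apply: is_derive_eq.
  by rewrite /GRing.scale /= !mulr1 -mulr2n.
have qc : {within `[(0 : R), 1], continuous q}.
  by apply: derivable_within_continuous => t _; have [] := hq t.
have [t] := MVT ltr01 (fun t _ => hq t) qc.
rewrite in_itv /= => /andP[t0 t1]; rewrite subr0 mulr1 => E.
have dq0 : 0 <= dq t.
  have := hsc (Y + t *: V) Y; rewrite addrAC subrr add0r.
  rewrite frob_dotZr sqr_frob_norm frob_dotZl frob_dotZr mulrCA ler_pM2l//.
  by rewrite frob_dotDl frob_dotNl /dq -[t *+ 2]mulr_natr; lra.
move: dq0; rewrite -E /q /bregman -/V scale1r scale0r addr0 [Y + V]addrC subrK.
rewrite !expr2; lra.
Qed.

Lemma gradient_monotone_bregman h X Y :
  bregman h X Y + bregman h Y X = frob_dot (grad h X - grad h Y) (X - Y).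
Proof.
rewrite /bregman -(opprB X Y) frob_dotNr frob_dotDl frob_dotNl; ring.
Qed.

(** The mean value theorem is applied to the component of grad h along the
    difference P of its values; the second derivative is bounded on the
    compact ball in each of the finitely many coordinate directions. *)
Lemma grad_C2_lipschitz_on_ball h (b : R) : twice_continuously_differentiable h ->
  exists2 K : R, 0 <= K & forall X Y, frob_norm X <= b -> frob_norm Y <= b ->
     frob_norm (grad h X - grad h Y) <= K * frob_norm (X - Y).
Proof.
move=> [dh ddh cdd].
pose ball := [set X : 'M[R]_(m, n) | frob_norm X <= b].
have kball : compact ball by exact: compact_frob_ball.
have bd (V : 'M[R]_(m, n)) : exists M, forall Z, frob_norm Z <= b ->
    frob_norm ('d (grad h) Z V) <= M.
  have [ne|ne] := pselect (ball !=set0); last first.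
    by exists 0 => Z Zb; case: ne; exists Z.
  have := @compact_EVT_max _ R (fun Z => frob_norm ('d (grad h) Z V)) ball ne kball.
  case=> [|c _ hc].
    apply: continuous_subspaceT => Z.
    exact: (continuous_comp (@cdd V Z) (@frob_norm_continuous _ _ _ _)).
  by exists (frob_norm ('d (grad h) c V)) => Z Zb; apply: hc; rewrite inE.
have [M hM] := choice (fun ij : 'I_m * 'I_n => bd (delta_mx ij.1 ij.2)).
exists (\sum_ij `|M ij|); first exact: sumr_ge0.
move=> X Y Xb Yb; set P := grad h X - grad h Y.
have [P0|Pn0] := eqVneq (frob_norm P) 0.
  by rewrite P0 mulr_ge0 ?frob_norm_ge0// sumr_ge0.
have Ppos : 0 < frob_norm P by rewrite lt0r Pn0 frob_norm_ge0.
rewrite -(ler_pM2l Ppos).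
set V := X - Y; pose psi (t : R) := frob_dot P (grad h (Y + t *: V)).
have hpsi (t : R) : is_derive t 1 psi (frob_dot P ('d (grad h) (Y + t *: V) V)).
  pose Z := Y + t *: V.
  have E : (fun e : R => e^-1 *: ((psi \o shift t) (e *: 1) - psi t)) =
      (fun e : R => frob_dot P (e^-1 *: ((grad h \o shift Z) (e *: V) - grad h Z))).
    apply/funext => e /=; rewrite frob_dotZr frob_dotDr frob_dotNr.
    rewrite /psi; have -> : e *: 1 + t = e + t by rewrite -[e *: 1]/(e * 1) mulr1.
    have -> : Y + (e + t) *: V = e *: V + Z by rewrite /Z scalerDl addrCA.
    by [].
  have c : (fun e : R => e^-1 *: ((psi \o shift t) (e *: 1) - psi t)) e @[e --> 0^'] -->
      frob_dot P ('d (grad h) Z V).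
    rewrite E; apply: continuous_frob_dot; first exact: cvg_cst.
    rewrite -deriveE; last exact: ddh.
    exact: (diff_derivable (ddh Z)).
  split; first by apply/cvg_ex; exists (frob_dot P ('d (grad h) Z V)).
  exact: cvg_lim c.
have cpsi : {within `[(0 : R), 1], continuous psi}.
  by apply: derivable_within_continuous => t _; have [] := hpsi t.
have [t] := MVT ltr01 (fun t _ => hpsi t) cpsi.
rewrite in_itv /= => /andP[t0 t1]; rewrite subr0 mulr1.
rewrite /psi scale1r scale0r addr0 [Y + V]addrC subrK -frob_dotNr -frob_dotDr -/P.
rewrite -sqr_frob_norm expr2 => ->.
apply: le_trans (cauchy_schwarz _ _) _; rewrite ler_wpM2l ?frob_norm_ge0//.
set Z := Y + t *: V.
have Zb : frob_norm Z <= b by apply: frob_norm_segment; rewrite // (ltW t0) ltW.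
rewrite [V in 'd _ Z V](matrix_sum_delta V) pair_bigA /= linear_sum /=.
apply: (@le_trans _ _ (\sum_ij frob_norm ('d (grad h) Z (V ij.1 ij.2 *: delta_mx ij.1 ij.2)))).
  elim/big_ind2 : _ => [|A a B c Aa Bc|//]; first by rewrite frob_norm0.
  exact: le_trans (ler_frob_normD _ _) (lerD Aa Bc).
rewrite mulr_suml; apply: ler_sum => ij _; rewrite linearZ /= frob_normZ mulrC.
apply: ler_pM => //; [exact: frob_norm_ge0| |exact: entry_le_frob_norm].
by apply: le_trans (hM ij Z Zb) _; exact: ler_norm.
Qed.
End calculus.

(** * The gradient of F composed with the Gram map *)

Section gram.
Variables (R : realType) (n r : nat).
Implicit Types (X Y V : 'M[R]_(n, r)).

Lemma cvg_mx (T : Type) (G : set_system T) {FG : Filter G} p q (f : T -> 'M[R]_(p, q))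
    (L : 'M[R]_(p, q)) :
  (forall i j, f x i j @[x --> G] --> L i j) -> f x @[x --> G] --> L.
Proof.
move=> H; apply/cvgrPdist_lt => e e0.
have : \forall x \near G, forall ij : 'I_p * 'I_q, `|L ij.1 ij.2 - f x ij.1 ij.2| < e.
  apply: filter_forall => ij.
  by have /cvgrPdist_lt := H ij.1 ij.2; apply.
apply: filterS => x hx; rewrite /Num.norm /= mx_normrE.
by apply: bigmax_lt => // ij _; rewrite !mxE.
Qed.

Definition gram X Y : 'M[R]_n := X *m Y^T.

Lemma gram_bilinear : bilinear_for
  (GRing.Scale.Law.clone _ _ *:%R _) (GRing.Scale.Law.clone _ _ *:%R _) gram.
Proof.
split=> [Y|X] a x y /=; first by rewrite /gram mulmxDl scalemxAl.
by rewrite /gram linearP /= mulmxDr scalemxAr.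
Qed.

HB.instance Definition _ := bilinear_isBilinear.Build R
  'M[R]_(n, r) 'M[R]_(n, r) 'M[R]_n _ _ gram gram_bilinear.

Lemma gram_continuous :
  continuous (fun p : 'M[R]_(n, r) * 'M[R]_(n, r) => gram p.1 p.2).
Proof.
move=> p; apply: cvg_mx => i j.
under [X in X @ _ --> _]funext do rewrite mxE; rewrite mxE.
apply: (@cvg_big R _ +%R 0 xpredT _ _ (nbhs p)) => [|k _].
  by move=> x; apply: cvgD; [exact: cvg_fst|exact: cvg_snd].
under [X in X @ _ --> _]funext do rewrite mxE; rewrite mxE.
apply: cvgM.
  exact: (cvg_comp fst (fun M : 'M[R]_(n, r) => M i k) cvg_fst (@coord_continuous _ _ _ i k p.1)).
exact: (cvg_comp snd (fun M : 'M[R]_(n, r) => M j k) cvg_snd (@coord_continuous _ _ _ j k p.2)).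
Qed.

Section composition.
Variables (F : 'M[R]_n -> R) (f : 'M[R]_(n, r) -> R).
Hypothesis dF : forall Z : 'M[R]_n, differentiable F Z.
Hypothesis fE : forall X, f X = F (X *m X^T).

Let diag X : 'M[R]_(n, r) * 'M[R]_(n, r) := (X, X).

Let fcomp : f = F \o (fun p => gram p.1 p.2) \o diag.
Proof. by apply/funext => X; rewrite fE. Qed.

Lemma gram_comp_differentiable X : differentiable f X.
Proof.
rewrite fcomp; apply: differentiable_comp; first exact: differentiable_pair.
apply: differentiable_comp; last exact: dF.
exact: differentiable_bilin gram_continuous.
Qed.

(** The differential at X sends V to the differential of F at X X^T applied to
    X V^T + V X^T; the formula is its adjoint. *)
Lemma grad_gram X :
  grad f X = (grad F (X *m X^T) + (grad F (X *m X^T))^T) *m X.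
Proof.
set G := grad F _.
have key V : frob_dot (grad f X) V = frob_dot ((G + G^T) *m X) V.
  rewrite frob_dot_grad; last exact: gram_comp_differentiable.
  have dp : differentiable (fun p : 'M[R]_(n, r) * 'M[R]_(n, r) => gram p.1 p.2) (diag X).
    exact: differentiable_bilin gram_continuous.
  have dd : differentiable diag X by exact: differentiable_pair.
  have E : 'd f X V = 'd F (X *m X^T) (X *m V^T + V *m X^T).
    rewrite fcomp diff_comp //; last by apply: differentiable_comp.
    rewrite /= diff_comp //=.
    rewrite diff_bilin; last exact: gram_continuous.
    by rewrite /= diff_pair//= !diff_val.
  rewrite E -frob_dot_grad// -/G.
  rewrite frob_dotDr [RHS]/frob_dot mulmxDl [(_ + _)^T]linearD /= mulmxDl linearD /=.
  rewrite !trmx_mul trmxK addrC; congr (_ + _); rewrite /frob_dot.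
    by rewrite mulmxA mxtrace_mulC mulmxA.
  by rewrite mxtrace_mulC -mulmxA mxtrace_mulC -mxtrace_tr !trmx_mul !trmxK mulmxA.
apply/eqP; rewrite -subr_eq0; apply/eqP; apply: frob_dot_eq0.
by rewrite {1}/GRing.add /= frob_dotDl frob_dotNl key subrr.
Qed.
End composition.

Lemma frob_norm_tr p q (A : 'M[R]_(p, q)) : frob_norm A^T = frob_norm A.
Proof. by rewrite /frob_norm /frob_dot trmxK mxtrace_mulC. Qed.

Lemma frob_norm_mul p q s (A : 'M[R]_(p, q)) (B : 'M[R]_(q, s)) :
  frob_norm (A *m B) <= frob_norm A * frob_norm B.
Proof.
rewrite -(ler_pXn2r (n := 2)) ?nnegrE ?frob_norm_ge0 ?mulr_ge0 ?frob_norm_ge0//.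
rewrite exprMn !sqr_frob_norm !frob_dotE.
rewrite -(pair_bigA _ (fun i j => (A *m B) i j * (A *m B) i j)) /=.
rewrite -(pair_bigA _ (fun i j => A i j * A i j)) /= mulr_suml.
apply: ler_sum => i _.
have -> : \sum_ij B ij.1 ij.2 * B ij.1 ij.2 = \sum_j \sum_k B k j * B k j.
  by rewrite -(pair_bigA _ (fun i j => B i j * B i j)) exchange_big.
rewrite mulr_sumr; apply: ler_sum => j _.
have := cauchy_schwarz (row i A) (col j B)^T.
have E1 : frob_dot (row i A) (col j B)^T = (A *m B) i j.
  rewrite frob_dotE -(pair_bigA _ (fun k l => row i A k l * (col j B)^T k l)) big_ord1 /= mxE.
  by apply: eq_bigr => k _; rewrite !mxE.
have E2 : frob_norm (row i A) ^+ 2 = \sum_k A i k * A i k.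
  rewrite sqr_frob_norm frob_dotE -(pair_bigA _ (fun k l => row i A k l * row i A k l)) big_ord1 /=.
  by apply: eq_bigr => k _; rewrite !mxE.
have E3 : frob_norm (col j B)^T ^+ 2 = \sum_k B k j * B k j.
  rewrite sqr_frob_norm frob_dotE -(pair_bigA _ (fun k l => (col j B)^T k l * (col j B)^T k l)) big_ord1 /=.
  by apply: eq_bigr => k _; rewrite !mxE.
have := cauchy_schwarz (- row i A) (col j B)^T.
rewrite frob_dotNl frob_normN E1 -E2 -E3 -expr2 -exprMn => h1 h2.
have h : `|(A *m B) i j| <= frob_norm (row i A) * frob_norm (col j B)^T.
  by rewrite ler_norml lerNl h1 h2.
rewrite -[X in X <= _]real_normK ?num_real//.
by rewrite ler_sqr ?nnegrE ?mulr_ge0 ?frob_norm_ge0.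
Qed.

(** Since X X^T is quadratic, the gradient of f need not be globally Lipschitz, but
    it is a product of bounded Lipschitz factors on a ball. *)
Lemma gram_comp_lipschitz_on_ball (F : 'M[R]_n -> R) (f : 'M[R]_(n, r) -> R) (LF b : R) :
  (forall Z : 'M[R]_n, differentiable F Z) -> (forall X, f X = F (X *m X^T)) ->
  0 <= LF -> smooth LF F -> 0 <= b ->
  exists2 K : R, 0 <= K & forall X Y, frob_norm X <= b -> frob_norm Y <= b ->
    frob_norm (grad f X - grad f Y) <= K * frob_norm (X - Y).
Proof.
move=> dF fE LF0 sF b0.
pose g0 := frob_norm (grad F 0).
have g00 : 0 <= g0 by exact: frob_norm_ge0.
pose M := g0 + LF * (b * b).
have M0 : 0 <= M by rewrite addr_ge0// mulr_ge0// mulr_ge0.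
have bb0 : 0 <= LF * (2 * b) by rewrite mulr_ge0// mulr_ge0.
exists (2 * M + 2 * (LF * (2 * b)) * b).
  by rewrite addr_ge0// ?mulr_ge0.
move=> X Y Xb Yb; rewrite !(grad_gram dF fE).
set GX := grad F (X *m X^T); set GY := grad F (Y *m Y^T).
set D := frob_norm (X - Y).
have D0 : 0 <= D by exact: frob_norm_ge0.
have hM : frob_norm GX <= M.
  have -> : GX = grad F 0 + (GX - grad F 0) by rewrite addrC subrK.
  apply: le_trans (ler_frob_normD _ _) _; rewrite lerD2l.
  apply: le_trans (sF _ _) _; rewrite subr0 ler_wpM2l//.
  apply: le_trans (frob_norm_mul _ _) _; rewrite frob_norm_tr.
  by apply: ler_pM => //; exact: frob_norm_ge0.
have hD : frob_norm (GX - GY) <= LF * (2 * b) * D.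
  apply: le_trans (sF _ _) _; rewrite -mulrA ler_wpM2l//.
  have -> : X *m X^T - Y *m Y^T = X *m (X - Y)^T + (X - Y) *m Y^T.
    by rewrite linearB /= mulmxBr mulmxBl addrA subrK.
  apply: le_trans (ler_frob_normD _ _) _.
  rewrite mulrDl mul1r mulrDl; apply: lerD; apply: le_trans (frob_norm_mul _ _) _.
    by rewrite frob_norm_tr ler_wpM2r.
  by rewrite frob_norm_tr mulrC ler_wpM2r.
have -> : (GX + GX^T) *m X - (GY + GY^T) *m Y =
    (GX + GX^T) *m (X - Y) + ((GX - GY) + (GX - GY)^T) *m Y.
  have -> : (GX - GY) + (GX - GY)^T = (GX + GX^T) - (GY + GY^T).
    have -> : (GX - GY)^T = GX^T - GY^T by apply/matrixP => i j; rewrite !mxE.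
    by rewrite addrACA -opprD.
  by rewrite mulmxBr mulmxBl addrA subrK.
apply: le_trans (ler_frob_normD _ _) _; rewrite mulrDl; apply: lerD.
  apply: le_trans (frob_norm_mul _ _) _; rewrite ler_wpM2r//.
  apply: le_trans (ler_frob_normD _ _) _; rewrite frob_norm_tr mulrDl mul1r.
  exact: lerD.
apply: le_trans (frob_norm_mul _ _) _.
apply: (@le_trans _ _ (2 * (LF * (2 * b) * D) * b)).
  apply: ler_pM; rewrite ?frob_norm_ge0//.
  apply: le_trans (ler_frob_normD _ _) _; rewrite frob_norm_tr mulrDl mul1r.
  exact: lerD.
by rewrite -!mulrA ler_wpM2l// ler_wpM2l// ler_wpM2l// ler_wpM2l// mulrC.
Qed.
End gram.

(** * One Bregman step *)

Section bregman_step.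
Variables (R : realType) (n r : nat).
Variables (f h : 'M[R]_(n, r) -> R) (g : 'M[R]_(n, r) -> \bar R).
Hypothesis dh : forall X, differentiable h X.
Hypothesis g_closed : closed_fun g.
Hypothesis g_ninfty : forall X, g X != -oo%E.
Implicit Types X Y U V : 'M[R]_(n, r).

(** A continuous summand only shears the epigraph. *)
Lemma closed_epigraph_add (q : 'M[R]_(n, r) -> R) : continuous q ->
  closed [set p : 'M[R]_(n, r) * R | (g p.1 + (q p.1)%:E <= p.2%:E)%E].
Proof.
move=> cq.
have -> : [set p : 'M[R]_(n, r) * R | (g p.1 + (q p.1)%:E <= p.2%:E)%E] =
    (fun p : 'M[R]_(n, r) * R => (p.1, p.2 - q p.1)) @^-1`
    [set p : 'M[R]_(n, r) * R | (g p.1 <= p.2%:E)%E].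
  apply/seteqP; split=> -[x v] /=; case: (g x) => [y| |] //=;
    by rewrite -?EFinD ?lee_fin ?leNye//; lra.
apply: preimage_closed g_closed => p _.
apply: (@cvg_pair _ _ _ (nbhs p) (nbhs p.1) (nbhs (p.2 - q p.1)) _ _ _ fst
  (fun p => p.2 - q p.1) cvg_fst).
apply: cvgB; first exact: cvg_snd.
exact: (cvg_comp fst q cvg_fst (cq p.1)).
Qed.

(** The part of the model minimized by the Bregman step that does not involve g. *)
Definition smooth_model (lambda : R) X U : R :=
  f X + frob_dot (grad f X) (U - X) + lambda^-1 * bregman h U X.

Lemma smooth_model_continuous lambda X : continuous (smooth_model lambda X).
Proof.
have ch : continuous h by move=> U; exact: differentiable_continuous.
have cd (A : 'M[R]_(n, r)) : continuous (fun U : 'M[R]_(n, r) => frob_dot A (U - X)).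
  move=> U; apply: (@continuous_frob_dot R n r _ (nbhs U) _ (fun=> A)); first exact: cvg_cst.
  exact: (@cvgB _ _ _ (nbhs U) _ id (fun=> X) U X cvg_id (@cvg_cst _ _ _ _ _)).
have cc (a : R) : continuous (fun _ : 'M[R]_(n, r) => a) by exact: cst_continuous.
move=> U; rewrite /smooth_model /bregman.
apply: (@cvgD _ _ _ (nbhs U)); first exact: (@cvgD _ _ _ (nbhs U) _ _ _ _ _ (cc _ U) (cd _ U)).
apply: (@cvgM _ _ (nbhs U)); first exact: cc.
apply: (@cvgB _ _ _ (nbhs U)); last exact: cd.
exact: (@cvgB _ _ _ (nbhs U) _ _ _ _ _ (ch U) (cc _ U)).
Qed.

Lemma smooth_model_id lambda X : smooth_model lambda X X = f X.
Proof. by rewrite /smooth_model /bregman !subrr !frob_dot0r subr0 mulr0 !addr0. Qed.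

(** The model dominates Psi by assumption, so its sublevel set at the value of X is
    bounded. A minimizer is found by minimizing the height over the compact
    part of the epigraph below that value. *)
Lemma admissible_step_exists lambda X (lo : R) : 0 < lambda ->
  (forall U, f U <= smooth_model lambda X U) ->
  coercive (objective f g) -> (forall U, (lo%:E <= objective f g U)%E) ->
  (objective f g X < +oo)%E -> exists U, admissible_step f g h lambda X U.
Proof.
move=> l0 fle coer lob Xfin.
have [hi gX] : exists hi : R, (g X + (f X)%:E = hi%:E)%E.
  move: Xfin; rewrite /objective; have := g_ninfty X.
  by case: (g X) => [y| |] // _ _; exists (y + f X).
have [b hb] := coer hi.
have modelE U : bregman_model f g h lambda X U = (g U + (smooth_model lambda X U)%:E)%E by [].
have model_ge U : (objective f g U <= bregman_model f g h lambda X U)%E.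
  by rewrite modelE /objective addeC; apply: leeD2l; rewrite lee_fin.
have lohi : lo <= hi by rewrite -lee_fin -gX addeC; exact: lob.
pose E := [set p : 'M[R]_(n, r) * R | (frob_norm p.1 <= b /\ lo <= p.2 <= hi) /\
   (g p.1 + (smooth_model lambda X p.1)%:E <= p.2%:E)%E].
have inball U : (bregman_model f g h lambda X U <= hi%:E)%E -> frob_norm U <= b.
  move=> hU; rewrite leNgt; apply/negP => /hb; rewrite ltNge.
  by rewrite (le_trans (model_ge U) hU).
have XE : E (X, hi).
  split; last by rewrite /= smooth_model_id gX.
  by split; [apply: inball; rewrite modelE smooth_model_id gX|rewrite lohi lexx].
have kE : compact E.
  have -> : E = ([set U | frob_norm U <= b] `*` `[lo, hi]%classic) `&`
      [set p | (g p.1 + (smooth_model lambda X p.1)%:E <= p.2%:E)%E].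
    by apply/seteqP; split=> -[U v] /=; rewrite in_itv.
  apply: compact_closedI.
    by apply: compact_setX; [exact: compact_frob_ball|exact: segment_compact].
  exact: closed_epigraph_add (@smooth_model_continuous lambda X).
have [|[U v]] := @compact_EVT_min _ R snd E (ex_intro _ _ XE) kE.
  by apply: continuous_subspaceT => p; exact: cvg_snd.
rewrite inE => -[[/= Ub /andP[lov vhi]] Uv] vmin.
exists U; split; last exact: fle.
move=> W; rewrite (modelE U); apply: le_trans Uv _.
have [Whi|/ltW hiW] := leP (bregman_model f g h lambda X W) hi%:E; last first.
  by apply: le_trans hiW; rewrite lee_fin.
have := lob W; have := model_ge W; have Wb := inball W Whi.
move: Whi; case EW: (bregman_model f g h lambda X W) => [w| |] // Whi h1 h2.
  rewrite lee_fin; apply: (vmin (W, w)); rewrite inE; split; last by rewrite /= -modelE EW.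
  by split=> //=; rewrite -!lee_fin Whi (le_trans h2 h1).
by move: (le_trans h2 h1).
Qed.

Hypothesis g_convex : convex_fun g.

Lemma bregman_map_finite lambda X U : (g X < +oo)%E ->
  bregman_map f g h lambda X U -> (g U < +oo)%E.
Proof.
move=> gX /(_ X); rewrite /bregman_model.
move: gX (g_ninfty X); case: (g X) => [y| |] // _ _.
by case: (g U) => [u| |] // _; exact: ltry.
Qed.

(** Compare U with U + t (Y - U), use the convexity of g, divide by t and let t
    tend to 0. *)
Lemma bregman_map_subgradient lambda X U : (g X < +oo)%E ->
  bregman_map f g h lambda X U ->
  subdifferential g U (- grad f X - lambda^-1 *: (grad h U - grad h X)).
Proof.
move=> gX hU Y.
have gU := bregman_map_finite gX hU.
have := g_ninfty U; have := g_ninfty Y.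
case EY : (g Y) => [y| |] // _; last by rewrite leey.
case EU : (g U) gU => [u| |] // _ _.
have [V VE] : exists V, V = Y - U by exists (Y - U).
rewrite -VE -EFinD lee_fin.
pose c t := (t^-1 * (h (U + t *: V) - h U)).
have step t : 0 < t < 1 ->
  0 <= (y - u) + frob_dot (grad f X) V + lambda^-1 * (c t - frob_dot (grad h X) V).
  move=> /andP[t0 t1].
  have gt : (g (U + t *: V) <= (t * y + (1 - t) * u)%:E)%E.
    have := @g_convex Y U t; rewrite t0 t1 EY EU => /(_ isT).
    by rewrite -!EFinM -EFinD VE; congr (g _ <= _)%E;
      rewrite scalerBr scalerBl scale1r addrC addrAC -addrA addrC.
  have := hU (U + t *: V); rewrite /bregman_model EU.
  move: gt (g_ninfty (U + t *: V)); case: (g _) => [w| |] //.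
  rewrite -!EFinD !lee_fin => hw _.
  have EV : U + t *: V - X = (U - X) + t *: V by rewrite addrAC.
  rewrite /bregman EV !frob_dotDr !frob_dotZr => hle.
  rewrite -(pmulr_rge0 _ t0) /c.
  have -> : t * (y - u + frob_dot (grad f X) V + lambda^-1 *
     (t^-1 * (h (U + t *: V) - h U) - frob_dot (grad h X) V)) =
     t * y - t * u + t * frob_dot (grad f X) V + lambda^-1 *
     ((h (U + t *: V) - h U) - t * frob_dot (grad h X) V).
    by move: (lambda^-1) => l; field; rewrite gt_eqF.
  lra.
have cc : c t @[t --> 0^'+] --> frob_dot (grad h U) V.
  apply: cvg_dnbhs_at_right.
  rewrite frob_dot_grad// -deriveE//.
  have -> : c = (fun t : R => t^-1 *: ((h \o shift U) (t *: V) - h U)).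
    by apply/funext => t; rewrite /c /= [t *: V + U]addrC.
  exact: (@diff_derivable _ _ _ h U V (dh U)).
have cl : (y - u) + frob_dot (grad f X) V + lambda^-1 * (c t - frob_dot (grad h X) V) @[t --> 0^'+]
   --> (y - u) + frob_dot (grad f X) V + lambda^-1 * (frob_dot (grad h U) V - frob_dot (grad h X) V).
  apply: cvgD; first exact: cvg_cst.
  apply: cvgM; first exact: cvg_cst.
  exact: (@cvgB _ _ _ _ _ _ _ _ _ cc (@cvg_cst _ _ _ _ _)).
have := cvgr_to_ge cl (b := 0) _.
rewrite !(frob_dotDl, frob_dotNl, frob_dotZl) => hfin.
suff : \forall t \near 0^'+, 0 <= y - u + frob_dot (grad f X) V + lambda^-1 * (c t - frob_dot (grad h X) V).
  by move/hfin; lra.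
near=> t; apply: step; apply/andP; split; near: t; [exact: nbhs_right_gt|exact: nbhs_right_lt].
Unshelve. all: by end_near.
Qed.

(** The subgradient inequality at U bounds g U by g X minus the symmetrized Bregman
    distance; the sufficient decrease condition costs one of its two halves,
    and the other one is at least sigma / 2 |U - X|^2. *)
Lemma bregman_map_decrease sigma lambda X U : 0 < lambda ->
  strongly_convex sigma h -> (g X < +oo)%E -> admissible_step f g h lambda X U ->
  (objective f g U + (lambda^-1 * (sigma / 2) * frob_dot (U - X) (U - X))%:E
    <= objective f g X)%E.
Proof.
move=> l0 hsc gX [hU hdec].
have gU := bregman_map_finite gX hU.
have := bregman_map_subgradient gX hU X; rewrite /objective.
have := g_ninfty U; have := g_ninfty X.
case EX : (g X) gX => [x| |] // _ _; case EU : (g U) gU => [u| |] // _ _.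
rewrite -!EFinD !lee_fin; move: hdec; rewrite /sufficient_decrease.
have := bregman_lower_bound X U dh hsc.
have := gradient_monotone_bregman h U X.
rewrite -[X - U]opprB !(frob_dotNl, frob_dotNr) opprK.
rewrite !(frob_dotDl (- _)) frob_dotNl frob_dotNl frob_dotZl => h1 h2 h3 h4.
have l1 : 0 < lambda^-1 by rewrite invr_gt0.
have h5 : lambda^-1 * (sigma / 2 * frob_dot (U - X) (U - X)) <= lambda^-1 * bregman h X U.
  by rewrite ler_pM2l.
have h6 : lambda^-1 * frob_dot (grad h U - grad h X) (U - X) =
   lambda^-1 * bregman h U X + lambda^-1 * bregman h X U by rewrite -h1 mulrDr.
lra.
Qed.
End bregman_step.

(** * Convergence of the iterates *)


Section sequences.
Variable R : realType.

(** Half of each step is paid by the previous step and the rest telescopes. *)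
Lemma bounded_length_of_recursion (d q : nat -> R) (c D : R) :
  (forall k, 0 <= d k) -> (forall k, `|q k| <= c) -> 0 <= D ->
  (forall k, 2 * d k.+1 <= d k + D * (q k - q k.+1)) ->
  forall N, \sum_(k < N) d k <= 2 * d 0%N + 2 * D * c.
Proof.
move=> d0 qc D0 rec N.
have claim M : \sum_(k < M.+1) d k + d M <= 2 * d 0%N + D * (q 0%N - q M).
  elim: M => [|M ih]; first by rewrite big_ord1 subrr mulr0; lra.
  by rewrite big_ord_recr /=; have := rec M; lra.
have h : D * (q 0%N - q N) <= D * (2 * c).
  by rewrite ler_wpM2l//; have := qc 0%N; have := qc N; rewrite !ler_norml; lra.
have := claim N; rewrite big_ord_recr /=; have := d0 N; lra.
Qed.

(** P are the values, d the step lengths and w the norms of subgradients. From the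
    decrease and the inequality for phi, a d_(k+1)^2 is at most b d_k times an
    increment of phi, and 2 sqrt (x y) <= x + y gives the recursion of
    [bounded_length_of_recursion]. *)
Lemma finite_length (P d w : nat -> R) (phi : R -> R) (v0 a b del c : R) :
  0 < a -> 0 <= b -> 0 < del -> (forall k, 0 <= d k) ->
  P k @[k --> \oo] --> v0 -> (forall k, v0 <= P k) ->
  (forall k, P k.+1 + a * d k ^+ 2 <= P k) -> (forall k, w k <= b * d k) ->
  (forall s t, 0 < s -> s < t -> t < del -> `|phi t| <= c /\ phi s <= phi t) ->
  (forall k s, w k <= 1 -> 0 < s -> s < P k.+1 - v0 -> P k.+1 - v0 < del ->
     P k.+1 - v0 - s <= w k * (phi (P k.+1 - v0) - phi s)) ->
  exists C : R, forall N, \sum_(k < N) d k <= C.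
Proof.
move=> a0 b0 del0 d0 cP v0le dec wle phiP KL.
have Pdec k : P k.+1 <= P k.
  by apply: le_trans (dec k); rewrite lerDl mulr_ge0 ?sqr_ge0 ?(ltW a0).
have tail K : (exists C : R, forall N, \sum_(k < N) d (K + k)%N <= C) ->
    exists C : R, forall N, \sum_(k < N) d k <= C.
  move=> [C hC]; exists (\sum_(k < K) d k + C) => N.
  apply: le_trans (_ : \sum_(k < K + N) d k <= _).
    by rewrite [in leRHS]addnC big_split_ord /= lerDl sumr_ge0.
  by rewrite big_split_ord lerD2l.
have d_eq0 k : P k <= P k.+1 -> d k = 0.
  move=> h1; have h2 : a * d k ^+ 2 <= 0 by have := dec k; lra.
  move: h2; rewrite pmulr_rle0// => h3.
  by apply/eqP; rewrite -sqrf_eq0 eq_le h3 sqr_ge0.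
have [[K PK]|hne] := pselect (exists k, P k = v0).
  have Ple k : P (K + k)%N <= v0.
    by elim: k => [|k ih]; rewrite ?addn0 ?PK// addnS (le_trans (Pdec _) ih).
  apply: (tail K); exists 0 => N; rewrite big1// => k _.
  by apply: d_eq0; rewrite (le_trans (Ple k)).
pose e k := P k.+1 - v0.
have e0 k : 0 < e k.
  by rewrite subr_gt0 lt_neqAle v0le andbT; apply/eqP => E; apply: hne; exists k.+1.
have b1 : 0 < b + 1 by rewrite ltr_wpDl.
(* Below the level v0 + eps the decrease makes b d_k, hence w_k, at most 1. *)
pose eps := Num.min del (a / (b + 1) ^+ 2).
have eps0 : 0 < eps by rewrite lt_min del0 divr_gt0 ?exprn_gt0.
have [K hK] : exists K, forall k, (K <= k)%N -> P k < v0 + eps.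
  have := cvgr_lt (FF := eventually_filter) _ cP (v0 + eps).
  by rewrite ltrDl => /(_ eps0)[K _ hK]; exists K.
have w1 k : (K <= k)%N -> w k <= 1.
  move=> Kk; apply: le_trans (wle k) _.
  have h1 : a * d k ^+ 2 < a * (b + 1) ^- 2.
    have h2 : P k < v0 + a / (b + 1) ^+ 2.
      by apply: lt_le_trans (hK k Kk) _; rewrite lerD2l ge_min lexx orbT.
    by have := dec k; have := v0le k.+1; lra.
  rewrite ltr_pM2l// -exprVn ltr_sqr ?nnegrE ?invr_ge0 ?(ltW b1)// in h1.
  apply: le_trans (_ : (b + 1) * (b + 1)^-1 <= 1); last by rewrite divff ?gt_eqF.
  by apply: ler_pM => //; [rewrite lerDl|exact: ltW].
have edel k : (K <= k)%N -> e k < del.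
  move=> Kk; have h1 : P k.+1 < v0 + eps by apply: hK; exact: leqW.
  by rewrite /e ltrBlDl; apply: lt_le_trans h1 _; rewrite lerD2l ge_min lexx.
have rec k : (K <= k)%N ->
    2 * d k.+1 <= d k + b / a * (phi (e k) - phi (e k.+1)).
  move=> Kk; have [ee|] := eqVneq (e k.+1) (e k).
    by rewrite ee subrr mulr0 addr0 d_eq0 ?mulr0//; move: ee; rewrite /e; lra.
  rewrite neq_lt => /orP[ee|]; last by rewrite /e ltrD2r ltNge Pdec.
  have [_ phile] := phiP _ _ (e0 k.+1) ee (edel k Kk).
  have hkl := KL k _ (w1 k Kk) (e0 k.+1) ee (edel k Kk).
  set Delta := phi (e k) - phi (e k.+1).
  have Delta0 : 0 <= Delta by rewrite subr_ge0.
  have h1 : e k - e k.+1 <= b * d k * Delta.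
    by apply: le_trans hkl _; rewrite ler_wpM2r.
  have h2 : d k.+1 ^+ 2 <= d k * (b / a * Delta).
    have -> : d k * (b / a * Delta) = (b * d k * Delta) / a by field; rewrite gt_eqF.
    by rewrite ler_pdivlMr// mulrC; apply: le_trans h1; have := dec k.+1; rewrite /e; lra.
  set D := b / a * Delta in h2 *.
  have D0 : 0 <= D by rewrite mulr_ge0// divr_ge0// ltW.
  have l0 : 0 <= 2 * d k.+1 by rewrite mulr_ge0.
  have r0 : 0 <= d k + D by rewrite addr_ge0.
  rewrite -ler_sqr ?nnegrE//.
  have -> : (d k + D) ^+ 2 = (d k - D) ^+ 2 + 4 * (d k * D) by ring.
  by rewrite exprMn; have := sqr_ge0 (d k - D); lra.
apply: (tail K); exists (2 * d (K + 0)%N + 2 * (b / a) * c) => N.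
apply: (bounded_length_of_recursion (d := fun k => d (K + k)%N)
  (q := fun k => phi (e (K + k)%N)) (D := b / a)) => //.
- move=> k; have hk := leq_addr k K.
  have [||//] := phiP (e (K + k)%N / 2) (e (K + k)%N) _ _ (edel _ hk).
    by rewrite divr_gt0.
  by rewrite ltr_pdivrMr// ltr_pMr// ltr1n.
- by rewrite divr_ge0// ltW.
- by move=> k; rewrite addnS; apply: rec; exact: leq_addr.
Qed.

Lemma cvg_of_bounded_length m n (y : nat -> 'M[R]_(m, n)) (C : R) :
  (forall N, \sum_(k < N) frob_norm (y k.+1 - y k) <= C) ->
  exists l : 'M[R]_(m, n), y k @[k --> \oo] --> l.
Proof.
move=> yC.
have cv i j : exists l : R, y k i j @[k --> \oo] --> l.
  pose u k := y k i j.
  have : cvgn (series (telescope u)).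
    apply: normed_cvg; apply: nondecreasing_is_cvgn.
      apply: (@nondecreasing_series R (fun k => `|telescope u k|) xpredT 0%N).
      by move=> *; exact: normr_ge0.
    exists C => _ [N _ <-]; apply: le_trans (yC N).
    rewrite /= seriesEord; apply: ler_sum => k _.
    have -> : telescope u k = (y k.+1 - y k) i j by rewrite /telescope /u !mxE.
    exact: entry_le_frob_norm.
  rewrite telescopeK => /cvg_ex[l hl]; exists (l + u 0%N).
  rewrite (_ : (fun k => y k i j) = (fun k => (u k - u 0%N) + u 0%N)).
    by apply: cvgD => //; exact: cvg_cst.
  by apply/funext => k; rewrite subrK.
have [l hl] := choice (fun ij : 'I_m * 'I_n => cv ij.1 ij.2).
exists (\matrix_(i, j) l (i, j)); apply: cvg_mx => i j.
by rewrite mxE; exact: (hl (i, j)).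
Qed.

Lemma cvg_frob_norm0 m n (y : nat -> 'M[R]_(m, n))
    (l : 'M[R]_(m, n)) :
  y k @[k --> \oo] --> l <-> frob_norm (y k - l) @[k --> \oo] --> (0 : R).
Proof.
split=> hy.
  have : y k - l @[k --> \oo] --> l - l by apply: cvgB => //; exact: cvg_cst.
  rewrite subrr => /(cvg_comp _ _)-/(_ _ _ _ (@frob_norm_continuous R m n 0)).
  by rewrite frob_norm0.
apply: cvg_mx => i j; apply/cvgrPdist_le => e e0.
have /cvgrPdist_le/(_ e e0) := hy; apply: filterS => k.
rewrite sub0r normrN ger0_norm ?frob_norm_ge0// => h.
by apply: le_trans h; have := entry_le_frob_norm (y k - l) i j; rewrite !mxE distrC.
Qed.

Lemma cvg_frob_norm_le m n p q (y : nat -> 'M[R]_(m, n)) (l : 'M[R]_(m, n))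
    (z : nat -> 'M[R]_(p, q)) (w : 'M[R]_(p, q)) (K : R) :
  (forall k, frob_norm (z k - w) <= K * frob_norm (y k - l)) ->
  y k @[k --> \oo] --> l -> z k @[k --> \oo] --> w.
Proof.
move=> h /cvg_frob_norm0 hy; apply/cvg_frob_norm0.
apply: (squeeze_cvgr (f := fun=> 0) (h := fun k => K * frob_norm (y k - l))).
- by apply: nearW => k; rewrite frob_norm_ge0 h.
- exact: cvg_cst.
- by rewrite -[X in _ --> X](mulr0 K); apply: cvgM => //; exact: cvg_cst.
Qed.
End sequences.

Section steps.
Variables (R : realType) (n r : nat).
Variables (f h : 'M[R]_(n, r) -> R) (g : 'M[R]_(n, r) -> \bar R).

(** In the dynamical rule a step is halved only when a step twice as large was
    refused, hence was larger than 1/L; and the next tentative step is not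
    smaller than the accepted one. *)
Lemma step_lower_bound (L lambda_max : R) (lambda : nat -> R) (X : nat -> 'M[R]_(n, r)) :
  0 < L -> (forall k, 0 < lambda k) ->
  (forall k l, 0 < l <= L^-1 -> exists U, admissible_step f g h l (X k) U) ->
  fixed_step_rule L lambda_max lambda \/ dynamical_step_rule f g h lambda_max lambda X ->
  exists2 lmin : R, 0 < lmin & forall k, lmin <= lambda k.
Proof.
move=> L0 l0 hadm [[l /andP[lpos _] hl]|].
  by exists l => // k; rewrite hl.
move=> [tent [j [/andP[t0 tmax] H]]].
have hL : 0 < L^-1 / 2 by rewrite divr_gt0 ?invr_gt0.
pose lmin := Num.min (tent 0%N) (L^-1 / 2).
have lmin0 : 0 < lmin by rewrite lt_min t0.
exists lmin => // k.
have lam m : lmin <= tent m -> lmin <= lambda m.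
  have [-> _ hno _] := H m; move: hno; case: (j m) => [_|i hno tm].
    by rewrite expr0 invr1 mul1r.
  have tm0 : 0 < tent m by apply: lt_le_trans tm.
  have s0 : 0 < 2 ^- i * tent m by rewrite mulr_gt0 ?invr_gt0 ?exprn_gt0.
  rewrite exprS invfM -mulrA ge_min; apply/orP; right.
  rewrite [leRHS]mulrC ler_pM2r ?invr_gt0// leNgt; apply/negP => hlt.
  by apply: (hno i (ltnSn i)); apply: hadm; rewrite s0 ltW.
suff : lmin <= tent k by exact: lam.
elim: k => [|k ih]; first by rewrite ge_min lexx.
have [E _ _ ->] := H k; rewrite le_min -mulrA -E.
have := lam k ih; have := l0 k => h1 h2.
have h3 : lmin <= lambda_max by apply: le_trans tmax; rewrite ge_min lexx.
by rewrite h3 andbT; lra.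
Qed.
End steps.

Theorem theorem3p1 (R : realType) (n r : nat)
  (hn : (1 <= n)%N) (hr : (1 <= r <= n)%N)
  (F : 'M[R]_n -> R) (muF LF : R) (hmuLF : 0 <= muF <= LF)
  (F_C2 : twice_continuously_differentiable F)
  (F_sc : strongly_convex muF F) (F_smooth : smooth LF F)
  (f : 'M[R]_(n, r) -> R) (f_def : forall X, f X = F (X *m X^T))
  (g : 'M[R]_(n, r) -> \bar R)
  (g_closed : closed_fun g) (g_convex : convex_fun g) (g_proper : proper_fun g)
  (Psi_bounded : (-oo < ereal_inf (range (objective f g)))%E)
  (h : 'M[R]_(n, r) -> R) (L : R) (hL : 0 < L)
  (h_kernel : distance_kernel h)
  (f_relsmooth : relatively_smooth L f h)
  (h_sc : exists2 sigma : R, 0 < sigma & strongly_convex sigma h)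
  (h_C2 : twice_continuously_differentiable h)
  (Psi_coercive : coercive (objective f g))
  (Psi_semialg : semialgebraic_fun (objective f g))
  (lambda_max : R) (hlambda_max : 0 < lambda_max)
  (X : nat -> 'M[R]_(n, r))
  (X_gen : dyn_nolips f g h L lambda_max X) :
  nonincreasing_seq (fun k => objective f g (X k)) /\
  exists Xstar : 'M[R]_(n, r),
    X k @[k --> \oo] --> Xstar /\ critical_point f g Xstar.
Proof.
have [sigma sigma0 hsc] := h_sc.
have [dF _ _] := F_C2; have [dh _ _] := h_C2.
have LF0 : 0 <= LF by case/andP: hmuLF => ? ?; apply: le_trans; eassumption.
have df := gram_comp_differentiable dF f_def.
have gninf := g_proper.1.
have [X0fin [lambda [hlam hrule]]] := X_gen.
have lpos k : 0 < lambda k by have [/andP[]] := hlam k.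
have lmaxk k : lambda k <= lambda_max by have [/andP[]] := hlam k.
have adm k : admissible_step f g h (lambda k) (X k) (X k.+1) by have [] := hlam k.
have gfin k : (g (X k) < +oo)%E.
  elim: k => [|k ih].
    move: X0fin; rewrite /objective; have := gninf (X 0%N).
    by case: (g (X 0%N)) => [y| |] // _ _; exact: ltry.
  exact: (bregman_map_finite gninf ih (adm k).1).
have ofin k : exists v : R, objective f g (X k) = v%:E.
  rewrite /objective; have := gninf (X k); have := gfin k.
  by case: (g (X k)) => [y| |] // _ _; exists (f (X k) + y).
have [P PE] := choice ofin.
have [lo lob] : exists lo : R, forall U, (lo%:E <= objective f g U)%E.
  have hle U : (ereal_inf (range (objective f g)) <= objective f g U)%E.
    by apply: ereal_inf_lbound; exists U.
  move: Psi_bounded hle; case: (ereal_inf _) => [v| |] // _ hle.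
    by exists v.
  by exists 0 => U; apply: le_trans (hle U); exact: leey.
pose d k := frob_norm (X k.+1 - X k).
have d0 k : 0 <= d k by exact: frob_norm_ge0.
pose a := lambda_max^-1 * (sigma / 2).
have a0 : 0 < a by rewrite mulr_gt0 ?invr_gt0 ?divr_gt0.
have dec k : P k.+1 + a * d k ^+ 2 <= P k.
  have := bregman_map_decrease dh gninf g_convex (lpos k) hsc (gfin k) (adm k).
  rewrite !PE -EFinD lee_fin; apply: le_trans; rewrite lerD2l sqr_frob_norm.
  rewrite ler_wpM2r ?frob_dot_ge0// ler_wpM2r ?divr_ge0 ?(ltW sigma0)//.
  by rewrite lef_pV2 ?posrE //.
have Pdec k : P k.+1 <= P k.
  by apply: le_trans (dec k); rewrite lerDl mulr_ge0 ?sqr_ge0 ?(ltW a0).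
split; first by apply/nonincreasing_seqP => k; rewrite !PE lee_fin.
have Pni : nonincreasing_seq P by apply/nonincreasing_seqP.
have Plo k : lo <= P k by rewrite -lee_fin -PE.
have cP : cvgn P by apply: nonincreasing_is_cvgn => //; exists lo => _ [k _ <-].
have [v0 cv0] : exists v0 : R, P k @[k --> \oo] --> v0 by exists (limn P); exact: cP.
have v0le k : v0 <= P k.
  by have := nonincreasing_cvgn_ge Pni (cvgP _ cv0) k; rewrite (cvg_lim _ cv0).
have [b hb] := Psi_coercive (P 0%N).
have Xb k : frob_norm (X k) <= b.
  rewrite leNgt; apply/negP => /hb; rewrite PE lte_fin ltNge.
  by rewrite (Pni 0%N k).
have b0 : 0 <= b by apply: le_trans (Xb 0%N); exact: frob_norm_ge0.
have [Kf Kf0 Kfle] := gram_comp_lipschitz_on_ball dF f_def LF0 F_smooth b0.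
have [Kh Kh0 Khle] := grad_C2_lipschitz_on_ball b h_C2.
have fle l : 0 < l <= L^-1 -> forall Y U, f U <= smooth_model f h l Y U.
  move=> /andP[lp lL] Y U; apply: le_trans (f_relsmooth U Y) _.
  rewrite lerD2l ler_wpM2r//; last by rewrite -[leLHS]invrK lef_pV2 ?posrE ?invr_gt0.
  apply: le_trans (bregman_lower_bound U Y dh hsc).
  by rewrite mulr_ge0 ?frob_dot_ge0// divr_ge0 ?(ltW sigma0).
have [lmin lmin0 hlmin] : exists2 lmin : R, 0 < lmin & forall k, lmin <= lambda k.
  apply: (step_lower_bound hL lpos _ hrule) => k l lL.
  apply: (admissible_step_exists dh g_closed gninf _ (fle l lL _) Psi_coercive lob).
    by case/andP: lL.
  by rewrite PE ltry.
pose V k := - grad f (X k) - (lambda k)^-1 *: (grad h (X k.+1) - grad h (X k)).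
have VP k : subdifferential g (X k.+1) (V k).
  exact: (bregman_map_subgradient dh gninf g_convex (gfin k) (adm k).1).
(* The sum is a subgradient of Psi at X_(k+1), small when the step is short. *)
pose W k := grad f (X k.+1) + V k.
pose cW := Kf + lmin^-1 * Kh.
have cW0 : 0 <= cW by rewrite addr_ge0// mulr_ge0// invr_ge0 ltW.
have Wle k : frob_norm (W k) <= cW * d k.
  have -> : W k = (grad f (X k.+1) - grad f (X k)) +
      - ((lambda k)^-1 *: (grad h (X k.+1) - grad h (X k))) by rewrite /W /V addrA.
  apply: le_trans (ler_frob_normD _ _) _; rewrite frob_normN frob_normZ mulrDl.
  apply: lerD; first exact: Kfle.
  rewrite -mulrA; apply: ler_pM; rewrite ?frob_norm_ge0//; last exact: Khle.
  by rewrite ger0_norm ?invr_ge0 ?(ltW (lpos k))// lef_pV2 ?posrE.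
have Psi_ninfty U : objective f g U != -oo%E.
  by rewrite /objective; have := gninf U; case: (g U).
have cf : continuous f by move=> U; exact: differentiable_continuous.
have Psi_closed : closed [set p : 'M[R]_(n, r) * R | (objective f g p.1 <= p.2%:E)%E].
  have := closed_epigraph_add g_closed cf.
  by under eq_set do rewrite addeC.
have crit k : frob_norm (W k) <= 1 ->
    level_subgradients (objective f g) (b ^+ 2) Kf v0 (P k.+1 - v0) (X k.+1, W k).
  move=> W1; split => /=.
  - by rewrite -sqr_frob_norm ler_sqr ?nnegrE ?frob_norm_ge0.
  - by rewrite -sqr_frob_norm -(expr1n _ 2) ler_sqr ?nnegrE ?frob_norm_ge0.
  - by rewrite PE subrKC.
  move=> y v; rewrite -sqr_frob_norm ler_sqr ?nnegrE ?frob_norm_ge0// => yb yv.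
  have h1 := first_order_error df Kf0 Kfle (Xb k.+1) yb.
  have := VP k y; move: yv (PE k.+1); rewrite /objective.
  case: (g y) => [gy| |] //; case: (g (X k.+1)) => [gx| |] //.
  rewrite -!EFinD !lee_fin => -[yv] [xv] h2.
  rewrite subrKC /W frob_dotDl -xv -yv; lra.
have [d1 [c [phi d10 hphi]]] :=
  desingularization (b ^+ 2) v0 Psi_semialg Psi_ninfty Psi_closed Kf0.
have [C hC] : exists C : R, forall N, \sum_(k < N) d k <= C.
  apply: (finite_length (phi := phi) (c := c) a0 cW0 d10 d0 cv0 v0le dec Wle).
    by move=> s t s0 st td; have [] := hphi s t s0 st td.
  move=> k s W1 s0 st td; have [_ _ _] := hphi _ _ s0 st td.
  by apply; exact: crit.
have [l cl] := cvg_of_bounded_length hC.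
exists l; split => //.
have lb : frob_norm l <= b.
  apply: (closed_cvg (fun Y : 'M[R]_(n, r) => frob_norm Y <= b) _ _ _ cl).
    exact: (compact_closed (@norm_hausdorff _ _) (@compact_frob_ball R n r b)).
  by apply: nearW => k; exact: Xb.
have cl1 : X k.+1 @[k --> \oo] --> l by rewrite (cvg_shiftS X).
have cg : grad f (X k.+1) @[k --> \oo] --> grad f l.
  by apply: (cvg_frob_norm_le _ cl1) => k; exact: Kfle.
have cd : X k.+1 - X k @[k --> \oo] --> (0 : 'M[R]_(n, r)).
  by rewrite -(subrr l); apply: cvgB.
have cw : W k @[k --> \oo] --> (0 : 'M[R]_(n, r)).
  by apply: (cvg_frob_norm_le _ cd) => k; rewrite !subr0; exact: Wle.
have cV : V k @[k --> \oo] --> - grad f l.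
  have -> : V = (fun k => W k - grad f (X k.+1)).
    by apply/funext => k; rewrite /W addrAC subrr add0r.
  by rewrite -[- grad f l]add0r; apply: cvgB.
exists (- grad f l); last by rewrite subrr.
move=> Y; have := gninf Y; case EY : (g Y) => [y| |] // _; last by rewrite leey.
have key : (g l <= (y - frob_dot (- grad f l) (Y - l))%:E)%E.
  pose z k : 'M[R]_(n, r) * R := (X k.+1, y - frob_dot (V k) (Y - X k.+1)).
  have cz : z k @[k --> \oo] --> (l, y - frob_dot (- grad f l) (Y - l)).
    apply: (@cvg_pair _ _ _ \oo (nbhs l) (nbhs (y - frob_dot (- grad f l) (Y - l)))
      _ _ _ (fun k => X k.+1)) => //.
    apply: (@cvgB _ _ _ \oo); first exact: cvg_cst.
    apply: continuous_frob_dot => //; apply: (@cvgB _ _ _ \oo) => //; exact: cvg_cst.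
  apply: (closed_cvg _ g_closed _ _ cz).
  apply: nearW => k /=; have := VP k Y; rewrite EY.
  by case: (g (X k.+1)) => [x| |] //; rewrite -?EFinD ?lee_fin ?leNye//; lra.
by move: key; case: (g l) => [x| |] //; rewrite -?EFinD ?lee_fin ?leNye//; lra.
Qed.
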